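(* Let $N\ge1$, $l_1,\dots,l_{2N}>0$, and let $z\in\mathbb{R}$ with $z>0$. The complex number $\lambda=iz^2$ is an eigenvalue of $\mathcal{A}_c$ if and only if $z$ satisfies the characteristic equation $$f(z)=m_{12}(z)=0,$$ where $m_{12}(z)$ is the entry on the first line and second column of the $2\times2$ matrix $M(z)$.
   Context: All functions are complex valued. $N\in\mathbb{N}^*$, $l_1,\dots,l_{2N}>0$. Operator $\mathcal{A}_c$. $V$ is the space of $\underline{u}=(u_1,\dots,u_{2N})\in\prod_{j=1}^N\big(H^1(0,l_{2j-1})\times H^2(0,l_{2j})\big)$ with $u_j(l_j)=u_{j+1}(0)$ for $1\le j\le 2N-1$, $u_1(0)=0$, $u_{2N}(l_{2N})=0$. Let $X=V\times\prod_{j=1}^{2N}L^2(0,l_j)$. Let $Y_c$ be the set of $(\underline{\Phi},\underline{\Psi})\in V\times V$ with $\Phi_{2j-1}\in H^2(0,l_{2j-1})$, $\Phi_{2j}\in H^4(0,l_{2j})$ for $j=1,\dots,N$ and - $\partial_x^2\Phi_{2j}(0)=\partial_x^2\Phi_{2j}(l_{2j})=0$, $j=1,\dots,N$; - $\partial_x^3\Phi_{2j}(0)+\partial_x\Phi_{2j-1}(l_{2j-1})=0$, $j=1,\dots,N$; - $\partial_x^3\Phi_{2j}(l_{2j})+\partial_x\Phi_{2j+1}(0)=0$, $j=1,\dots,N-1$. On $Y_c$ set $\mathcal{A}_c(\underline{\Phi},\underline{\Psi})=\big(\underline{\Psi},(\partial_x^2\Phi_{2j-1},-\partial_x^4\Phi_{2j})_{1\le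 j\le N}\big)\in X$. Let $P_{0,c}=\frac{1}{2\pi i}\oint_\gamma(\lambda I-\mathcal{A}_c)^{-1}d\lambda$ be the Riesz projection on $X$, $\gamma$ being a simple closed curve enclosing $0$ and no other eigenvalue; set $\mathcal{H}_c=(I-P_{0,c})X$, $\mathcal{D}(\mathcal{A}_c)=\mathcal{H}_c\cap Y_c$, and from then on $\mathcal{A}_c$ denotes its restriction $\mathcal{D}(\mathcal{A}_c)\to\mathcal{H}_c$. Matrices. For $z>0$ and $j=1,\dots,N$ put $c_{2j-1}=\cos(l_{2j-1}z^2)$, $s_{2j-1}=\sin(l_{2j-1}z^2)$, $c_{2j}=\cos(l_{2j}z)$, $s_{2j}=\sin(l_{2j}z)$, $$A_{2j-1}=\begin{pmatrix}c_{2j-1}&s_{2j-1}\\ -s_{2j-1}&c_{2j-1}\end{pmatrix},\qquad T=\begin{pmatrix}1&0\\ 0&-\frac1z\end{pmatrix},$$ $$A_{2j}=\frac{1}{e^{2l_{2j}z}-2e^{l_{2j}z}s_{2j}-1}\begin{pmatrix}e^{2l_{2j}z}(c_{2j}-s_{2j})-c_{2j}-s_{2j}&2s_{2j}(1-e^{2l_{2j}z})\\ e^{2l_{2j}z}c_{2j}-2e^{l_{2j}z}+c_{2j}&e^{2l_{2j}z}(c_{2j}-s_{2j})-c_{2j}-s_{2j}\end{pmatrix},$$ and $$M(z)=A_{2N}\,T\,A_{2N-1}\,T^{-1}A_{2N-2}\,T\,A_{2N-3}\cdots T^{-1}A_2\,T\,A_1 .$$ *)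

(* Defs.v *)
From HB Require Import structures.
From mathcomp Require Import all_boot all_order all_algebra.
From mathcomp Require Import all_classical all_reals all_analysis.
From mathcomp Require Import complex.

Set Implicit Arguments.
Unset Strict Implicit.
Unset Printing Implicit Defensive.

Import Order.TTheory GRing.Theory Num.Theory.
Import numFieldNormedType.Exports.

Local Open Scope classical_set_scope.
Local Open Scope ring_scope.
Local Open Scope complex_scope.

(* An element of L^2(0, l) is represented by any function R -> R[i] whose
   restriction to ]0, l[ belongs to its class. *)

Definition cfun (R : realType) : lmodType R[i] := (R -> R[i]^o).

Definition cmod (R : realType) (w : R[i]) : R := ComplexField.Normc.normc w.

Definition eq_on (R : realType) (l : R) (f g : cfun R) : Prop :=
  {ae @lebesgue_measure R, forall x, x \in `]0, l[ -> f x = g x}.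

Definition L2norm (R : realType) (l : R) (f : cfun R) : \bar R :=
  'N[@lebesgue_measure R]_2%:E [(fun x => (cmod (f x))%:E) \_ `]0, l[ ].

Definition inL2 (R : realType) (l : R) (f : cfun R) : Prop :=
  [/\ measurable_fun `]0, l[ (fun x => complex.Re (f x)),
      measurable_fun `]0, l[ (fun x => complex.Im (f x))
    & (L2norm l f < +oo)%E].

Definition cintegral (R : realType) (l : R) (f : cfun R) : R[i] :=
  (\int[@lebesgue_measure R]_(x in `]0, l[) complex.Re (f x))
  +i* (\int[@lebesgue_measure R]_(x in `]0, l[) complex.Im (f x)).

(* Test functions are C^1 with compact support in ]0, l[; real-valued ones
   suffice by linearity. *)
Definition test_function (R : realType) (l : R) (phi : R -> R) : Prop :=
  [/\ forall x, derivable phi x 1,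
      continuous (derive1 phi)
    & exists a b : R, [/\ 0 < a, a < b, b < l
        & forall x, x \notin `[a, b] -> phi x = 0]].

Definition is_weak_deriv (R : realType) (l : R) (f g : cfun R) : Prop :=
  forall phi : R -> R, test_function l phi ->
    cintegral l (fun x => f x * (derive1 phi x)%:C)
    = - cintegral l (fun x => g x * (phi x)%:C).

Fixpoint inH (R : realType) (l : R) (k : nat) (f : cfun R) : Prop :=
  inL2 l f /\
  (if k is k'.+1 then exists g, is_weak_deriv l f g /\ inH l k' g else True).

(* The weak derivative, as an L^2 function determined up to a.e. equality. *)
Definition wderiv (R : realType) (l : R) (f : cfun R) : cfun R :=
  xget 0 [set g | inL2 l g /\ is_weak_deriv l f g].

Definition wderivn (R : realType) (l : R) (k : nat) (f : cfun R) : cfun R :=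
  iter k (wderiv l) f.

(* Pointwise values of f in H^1(0, l), endpoints included, are those of the
   representative of f that is continuous on the closed interval [0, l]. *)
Definition crepr (R : realType) (l : R) (f : cfun R) : cfun R :=
  xget 0 [set h | [/\ {within `[0, l], continuous (fun x => complex.Re (h x))},
                      {within `[0, l], continuous (fun x => complex.Im (h x))}
                    & eq_on l f h]].

Definition trace (R : realType) (l : R) (f : cfun R) (x : R) : R[i] :=
  crepr l f x.

Definition Hsqnorm (R : realType) (l : R) (k : nat) (f : cfun R) : \bar R :=
  (\sum_(i < k.+1) L2norm l (wderivn l i f) ^+ 2)%E.

(* Components are indexed by 'I_(2 * N), that is from 0, so that the string
   u_{2j-1} has an even index and the beam u_{2j} an odd one. *)

Definition family (R : realType) (N : nat) : lmodType R[i] :=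
  ('I_(2 * N) -> cfun R).

Definition state (R : realType) (N : nat) : lmodType R[i] :=
  (family R N * family R N)%type.

Definition beam (N : nat) (i : 'I_(2 * N)) : bool := odd i.

Definition orderV (N : nat) (i : 'I_(2 * N)) : nat := if beam i then 2 else 1.

Definition inV (R : realType) (N : nat) (l : 'I_(2 * N) -> R)
    (u : family R N) : Prop :=
  [/\ forall i, inH (l i) (orderV i) (u i),
      forall i j : 'I_(2 * N), j = i.+1 :> nat ->
        trace (l i) (u i) (l i) = trace (l j) (u j) 0,
      forall i : 'I_(2 * N), i = 0%N :> nat -> trace (l i) (u i) 0 = 0
    & forall i : 'I_(2 * N), i.+1 = (2 * N)%N ->
        trace (l i) (u i) (l i) = 0].

Definition inX (R : realType) (N : nat) (l : 'I_(2 * N) -> R)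
    (U : state R N) : Prop :=
  inV l U.1 /\ forall i, inL2 (l i) (U.2 i).

(* Elements of X are states modulo a.e. equality of their components. *)
Definition eqX (R : realType) (N : nat) (l : 'I_(2 * N) -> R)
    (U W : state R N) : Prop :=
  forall i, eq_on (l i) (U.1 i) (W.1 i) /\ eq_on (l i) (U.2 i) (W.2 i).

Definition normX (R : realType) (N : nat) (l : 'I_(2 * N) -> R)
    (U : state R N) : \bar R :=
  ((\sum_i (Hsqnorm (l i) (orderV i) (U.1 i) + L2norm (l i) (U.2 i) ^+ 2))
     `^ 2^-1)%E.

Definition inY (R : realType) (N : nat) (l : 'I_(2 * N) -> R)
    (U : state R N) : Prop :=
  let d k i := wderivn (l i) k (U.1 i) in
  [/\ inV l U.1 /\ inV l U.2,
      forall i, inH (l i) (if beam i then 4 else 2) (U.1 i),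
      forall i, beam i ->
        trace (l i) (d 2 i) 0 = 0 /\ trace (l i) (d 2 i) (l i) = 0,
      forall i j : 'I_(2 * N), beam i -> i = j.+1 :> nat ->
        trace (l i) (d 3 i) 0 + trace (l j) (d 1 j) (l j) = 0
    & forall i j : 'I_(2 * N), beam i -> j = i.+1 :> nat ->
        trace (l i) (d 3 i) (l i) + trace (l j) (d 1 j) 0 = 0].

Definition opA (R : realType) (N : nat) (l : 'I_(2 * N) -> R)
    (U : state R N) : state R N :=
  (U.2, fun i => if beam i then - wderivn (l i) 4 (U.1 i)
                 else wderivn (l i) 2 (U.1 i)).

Definition is_eigenvalue (R : realType) (N : nat) (l : 'I_(2 * N) -> R)
    (D : set (state R N)) (lambda : R[i]) : Prop :=
  exists U : state R N,
    [/\ D U, ~ eqX l U 0 & eqX l (opA l U) (lambda *: U)].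

(* The estimate contains the injectivity of mu - opA. *)
Definition resolvent_set (R : realType) (N : nat) (l : 'I_(2 * N) -> R)
    (mu : R[i]) : Prop :=
  (forall x, inX l x ->
     exists y, inY l y /\ eqX l (mu *: y - opA l y) x) /\
  (exists C : R, forall y, inY l y ->
     (normX l y <= C%:E * normX l (mu *: y - opA l y)%R)%E).

Definition resolvent (R : realType) (N : nat) (l : 'I_(2 * N) -> R)
    (mu : R[i]) (x : state R N) : state R N :=
  xget 0 [set y | inY l y /\ eqX l (mu *: y - opA l y) x].

(* Contour integrals of V-valued functions along gamma : [0, 1] -> R[i], as
   limits for the (semi)norm nrm of the sums
   \sum_i (gamma t_(i+1) - gamma t_i) F(gamma tau_i) over the tagged
   subdivisions of [0, 1]; s lists t_1 < ... < t_n = 1. *)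
Definition tagged (R : realType) (delta : R) (s : seq R) (tau : nat -> R) :=
  itv_partition 0 1 s /\
  forall i, (i < size s)%N ->
    [/\ nth 1 (0 :: s) i <= tau i, tau i <= nth 1 s i
      & nth 1 s i - nth 1 (0 :: s) i < delta].

Definition is_contour_integral (R : realType) (V : lmodType R[i])
    (nrm : V -> \bar R) (gamma : R -> R[i]) (F : R[i] -> V) (v : V) : Prop :=
  forall eps : R, 0 < eps -> exists delta : R, 0 < delta /\
    forall s tau, tagged delta s tau ->
      (nrm (\sum_(i < size s)
              (gamma (nth 1 s i) - gamma (nth 1 (0 :: s) i))
                *: F (gamma (tau i)) - v)%R < eps%:E)%E.

Definition two_pi_i (R : realType) : R[i] := 0 +i* (2 * pi).

(* n = (2 pi i)^-1 * the integral along gamma of d zeta / (zeta - p). *)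
Definition winding (R : realType) (gamma : R -> R[i]) (p : R[i]) (n : int) :=
  @is_contour_integral R R[i]^o (fun w => (cmod w)%:E) gamma
    (fun zeta => (zeta - p)^-1) (two_pi_i R * n%:~R).

Definition simple_closed_curve (R : realType) (gamma : R -> R[i]) : Prop :=
  [/\ {within `[0, 1], continuous (fun t => complex.Re (gamma t))} /\
      {within `[0, 1], continuous (fun t => complex.Im (gamma t))},
      bounded_variation 0 1 (fun t => complex.Re (gamma t)) /\
      bounded_variation 0 1 (fun t => complex.Im (gamma t)),
      gamma 0 = gamma 1
    & {in `[0, 1[ &, injective gamma}].

(* "Enclosing" is expressed by winding numbers; winding number 1 around 0 also
   fixes the positive orientation of gamma. *)
Definition riesz_contour (R : realType) (N : nat) (l : 'I_(2 * N) -> R)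
    (gamma : R -> R[i]) : Prop :=
  [/\ simple_closed_curve gamma,
      forall t, t \in `[0, 1] -> resolvent_set l (gamma t),
      winding gamma 0 1
    & forall mu, is_eigenvalue l (inY l) mu -> mu != 0 -> winding gamma mu 0].

Definition riesz_proj (R : realType) (N : nat) (l : 'I_(2 * N) -> R)
    (gamma : R -> R[i]) (x : state R N) : state R N :=
  (two_pi_i R)^-1 *:
    xget 0 [set v | inX l v /\
      is_contour_integral (normX l) gamma (fun mu => resolvent l mu x) v].

Definition inHc (R : realType) (N : nat) (l : 'I_(2 * N) -> R)
    (gamma : R -> R[i]) (U : state R N) : Prop :=
  inX l U /\ exists x, inX l x /\ eqX l U (x - riesz_proj l gamma x).

Definition domAc (R : realType) (N : nat) (l : 'I_(2 * N) -> R)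
    (gamma : R -> R[i]) : set (state R N) :=
  [set U | inHc l gamma U /\ inY l U].

Definition mx22 (R : realType) (a b c d : R) : 'M[R]_2 :=
  \matrix_(i, j) if i == 0 then (if j == 0 then a else b)
                 else (if j == 0 then c else d).

Definition string_mx (R : realType) (l z : R) : 'M[R]_2 :=
  let c := cos (l * z ^+ 2) in let s := sin (l * z ^+ 2) in
  mx22 c s (- s) c.

Definition beam_mx (R : realType) (l z : R) : 'M[R]_2 :=
  let c := cos (l * z) in let s := sin (l * z) in
  let e := expR (l * z) in let e2 := expR (2 * l * z) in
  (e2 - 2 * e * s - 1)^-1 *:
    mx22 (e2 * (c - s) - c - s) (2 * s * (1 - e2))
         (e2 * c - 2 * e + c)   (e2 * (c - s) - c - s).

Definition junction_mx (R : realType) (z : R) : 'M[R]_2 :=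
  mx22 1 0 0 (- z^-1).

(* The factor of M(z) contributed by the i-th component: its transfer matrix
   times the junction matrix that links it to the preceding component. *)
Definition factor_mx (R : realType) (N : nat) (l : 'I_(2 * N) -> R) (z : R)
    (i : 'I_(2 * N)) : 'M[R]_2 :=
  if beam i then beam_mx (l i) z * junction_mx z
  else if i == 0%N :> nat then string_mx (l i) z
  else string_mx (l i) z * (junction_mx z)^-1.

(* The leftmost factor is that of the last component. *)
Definition char_mx (R : realType) (N : nat) (l : 'I_(2 * N) -> R) (z : R) :
    'M[R]_2 :=
  \prod_(i < 2 * N) factor_mx l z (rev_ord i).

(* Main.v *)
Require Import Defs.
From mathcomp Require Import all_boot all_order all_algebra.
From mathcomp Require Import all_classical all_reals all_analysis.
From mathcomp Require Import complex measurable_realfun.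
From mathcomp Require Import ring lra.

(** Why the theorem holds.  A pair U with A U = lambda U, lambda = i z^2, has
    second component lambda times the first, so the first one solves
    u'' = - z^4 u on the strings and u'''' = z^4 u on the beams, both in the
    weak sense, and lambda^2 = - z^4 being real, the real and the imaginary
    part of u solve them separately.  Attach to the ends of a string the vector
    (u, u' / z^2) and to the ends of a beam the vector (u, u''' / z^3).  On a
    string the first vector determines the last one by a rotation.  On a beam
    the two conditions u'' = 0 at the ends eliminate u' at the left end,
    because sin x < sinh x for x > 0, and again the first vector determines the
    last one ([string_transfer], [beam_transfer]); the junction conditions are
    multiplications by T or its inverse.  Hence the vector at the right end of
    the chain is M(z) times the one at the left end, which is (0, p) by the
    boundary condition, and the boundary condition on the right says
    m_12(z) p = 0.  If m_12(z) is nonzero then p = 0, all the vectors vanish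
    and so does u ([modal_char]).  If m_12(z) = 0, propagating (0, 1) gives
    the end vectors of explicit smooth solutions, which fit together to an
    eigenvector ([eigen_exists]).

    Two ingredients are analytic.  First, weak solutions are classical: a
    square-integrable f with weak derivative g is a constant plus a primitive
    of g ([weak_deriv_repr]), which comes from testing against functions that
    rise from 0 to 1 just after a Lebesgue point.  This yields the uniqueness
    of weak derivatives, the existence of continuous representatives, and their
    differentiability ([crepr_deriv]).  Second, the eigenvector must lie in the
    range of I - P_0.  For mu on the contour the resolvent multiplies U by
    (mu - lambda)^-1, so the integral sums that define P_0 U are multiples of U
    whose coefficients tend to 2 i pi times the winding number of the contour
    around lambda, which is zero.  Hence P_0 U = 0 and U = U - P_0 U
    ([riesz_proj_eigen]). *)

Set Implicit Arguments.
Unset Strict Implicit.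
Unset Printing Implicit Defensive.

Import Order.TTheory GRing.Theory Num.Theory.
Import numFieldNormedType.Exports.

Local Open Scope classical_set_scope.
Local Open Scope ring_scope.
Local Open Scope complex_scope.

(** * A continuously differentiable step *)

Section Step.
Context {R : realType}.
Implicit Types (a e t x : R) (f : R -> R).

Lemma is_derive_continuous f f' : (forall x, is_derive x 1 f (f' x)) ->
  continuous f.
Proof.
move=> df x; apply: differentiable_continuous; apply/derivable1_diffP.
by have [] := df x.
Qed.

(** A truncated power, the building block of quadratic splines: it is of class
    C^1 because its one-sided derivatives at 0 both vanish. *)
Definition sqpos t : R := (Num.max 0 t) ^+ 2.

Lemma is_derive_sqpos t : is_derive t 1 sqpos (2 * Num.max 0 t).
Proof.
have [t0|t0|->] : [\/ t < 0, 0 < t | t = 0].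
  by case: (ltgtP t 0) => ?; [apply: Or31|apply: Or32|apply: Or33].
- have -> : 2 * Num.max 0 t = 0 by rewrite max_l ?mulr0// ltW.
  apply: (@near_eq_is_derive _ _ _ (cst 0)) => //.
  near=> y; rewrite /sqpos/= max_l ?expr0n//.
  by apply: ltW; near: y; exact: lt_nbhsl.
- rewrite max_r ?ltW//.
  apply: (@near_eq_is_derive R R^o R^o (fun y : R^o => y ^+ 2)).
    near=> y; rewrite /sqpos max_r//.
    by apply: ltW; near: y; exact: lt_nbhsr.
  by apply: is_derive_eq; rewrite /GRing.scale/=; ring.
- rewrite max_l// mulr0.
  have E : (fun h : R => h^-1 *: ((sqpos \o shift 0) (h *: (1 : R)) - sqpos 0))
           @ 0^' --> (0 : R).
    apply/cvgrPdist_le => e e0; near=> h.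
    rewrite /= /sqpos sub0r normrN addr0 maxxx expr0n subr0 [_%:A]mulr1.
    rewrite [_ *: _]/GRing.scale/= normrM normrX normrV ?unitfE; last first.
      by near: h; exact: nbhs_dnbhs_neq.
    have h0 : h != 0 by near: h; exact: nbhs_dnbhs_neq.
    have hm : `|Num.max 0 h| <= `|h|.
      by case: (leP 0 h) => //; rewrite normr0.
    have he : `|h| <= e.
      near: h; exact: dnbhs0_le.
    apply: le_trans he; rewrite ler_pdivrMl ?normr_gt0//.
    by rewrite -expr2 lerXn2r ?nnegrE.
  split; first by apply/cvg_ex; exists 0.
  by apply: cvg_lim.
Unshelve. all: by end_near. Qed.

(** The second difference of [sqpos] on the grid 0, 1/2, 1: the quadratic terms
    cancel beyond 1, which leaves a C^1 step from 0 to 1. Its derivative is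
    [tent]. *)
Definition step t : R := 2 * sqpos t - 4 * sqpos (t - 2^-1) + 2 * sqpos (t - 1).

Definition tent t : R :=
  4 * Num.max 0 t - 8 * Num.max 0 (t - 2^-1) + 4 * Num.max 0 (t - 1).

Lemma is_derive_step_scaled a e x : is_derive x 1 (fun x => step ((x - a) / e))
  (e^-1 * tent ((x - a) / e)).
Proof.
rewrite /step /tent.
have D c : is_derive x 1 (fun y => sqpos ((y - a) / e - c))
   (e^-1 * (2 * Num.max 0 ((x - a) / e - c))).
  have := @is_derive1_comp _ sqpos (fun y => (y - a) / e - c) x.
  have D1 : is_derive x 1 (fun y => (y - a) / e - c) e^-1.
    apply: is_derive_eq.
    by rewrite !(scaler0, subr0, addr0, scaler1, scale1r, add0r).
  have := is_derive_sqpos ((x - a) / e - c) => D2 /(_ _ _ D2 D1).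
  move=> /is_derive_eq; apply; ring.
have D0 := D 0; rewrite subr0 in D0.
have E0 : (fun y => sqpos ((y - a) / e - 0)) = (fun y => sqpos ((y - a) / e)).
  by apply/funext => y; rewrite subr0.
rewrite E0 in D0.
have Dh := D (2^-1); have D1 := D 1.
apply: is_derive_eq.
rewrite /GRing.scale/=; ring.
Qed.

Lemma step_le0 t : t <= 0 -> step t = 0.
Proof.
by move=> t0; rewrite /step /sqpos !max_l ?expr0n/= ?mulr0 ?subr0 ?addr0//; lra.
Qed.

Lemma step_ge1 t : 1 <= t -> step t = 1.
Proof. by move=> t0; rewrite /step /sqpos !max_r; [field|lra..]. Qed.

Lemma step_bound t : `|step t| <= 1.
Proof.
rewrite ler_norml /step /sqpos.
case: (lerP 0 t) => h1; case: (lerP 0 (t - 2^-1)) => h2;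
  case: (lerP 0 (t - 1)) => h3; apply/andP; split; nra.
Qed.

Lemma tent_out t : (t <= 0) || (1 <= t) -> tent t = 0.
Proof.
rewrite /tent => /orP[] h; first by rewrite !max_l ?mulr0 ?subr0 ?addr0//; lra.
by rewrite !max_r; [field|lra..].
Qed.

Lemma tent_bound t : 0 <= tent t <= 2.
Proof.
rewrite /tent.
case: (lerP 0 t) => h1; case: (lerP 0 (t - 2^-1)) => h2;
  case: (lerP 0 (t - 1)) => h3; apply/andP; split; lra.
Qed.

Lemma continuous_tent_scaled a e : continuous (fun x => e^-1 * tent ((x - a) / e)).
Proof.
move=> x; apply: cvgM; first exact: cvg_cst.
rewrite /tent.
have C c : {for x, continuous (fun y => Num.max 0 ((y - a) / e - c))}.
  apply: continuous_max; first exact: cvg_cst.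
  apply: cvgB; last exact: cvg_cst.
  apply: cvgM; last exact: cvg_cst.
  by apply: cvgB; [exact: cvg_id|exact: cvg_cst].
apply: cvgD; first apply: cvgB.
- apply: cvgM; first exact: cvg_cst.
  have := C 0; rewrite /prop_for /continuous_at subr0.
  by under eq_fun do rewrite subr0.
- by apply: cvgM; [exact: cvg_cst|exact: C].
- by apply: cvgM; [exact: cvg_cst|exact: C].
Qed.

End Step.

(** * Weak derivatives at Lebesgue points *)

Section Repr.
Context {R : realType}.
Notation mu := (@lebesgue_measure R).
Implicit Types (a b e l t x : R) (f g h : R -> R).

Lemma ae_mono (P Q : R -> Prop) : (forall x, P x -> Q x) ->
  {ae mu, forall x, P x} -> {ae mu, forall x, Q x}.
Proof. by move=> PQ; apply: negligibleS => x /= nQ /PQ. Qed.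

Lemma ae_mono2 (P1 P2 Q : R -> Prop) : (forall x, P1 x -> P2 x -> Q x) ->
  {ae mu, forall x, P1 x} -> {ae mu, forall x, P2 x} -> {ae mu, forall x, Q x}.
Proof.
move=> PQ ae1 ae2; have := negligibleU ae1 ae2; apply: negligibleS => x /= nQ.
by apply/not_andP => -[p1 p2]; apply: nQ; exact: PQ.
Qed.

(** An open interval has positive measure, so it is not negligible. *)
Lemma ae_itv_exists a b (P : R -> Prop) : a < b ->
  {ae mu, forall x, x \in `]a, b[ -> P x} -> exists2 x, x \in `]a, b[ & P x.
Proof.
move=> ab aeP; apply: contrapT => nP.
have N : mu.-negligible `]a, b[%classic.
  apply: negligibleS aeP => x /= xab; apply/existsNP.
  by exists xab => Px; apply: nP; exists x.
have : mu `]a, b[%classic = 0.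
  by apply: measure_negligible N; exact: measurable_itv.
rewrite lebesgue_measure_itv/= lte_fin ab => /eqP.
by rewrite -EFinB eqe subr_eq0 => /eqP ba; rewrite ba ltxx in ab.
Qed.

Lemma integrableM_le l f h (M : R) : measurable_fun setT h ->
  (forall x, `|h x| <= M) ->
  mu.-integrable `]0, l[ (EFin \o f) ->
  mu.-integrable `]0, l[ (EFin \o (fun x => f x * h x)).
Proof.
move=> mh hM intf.
have -> : EFin \o (fun x => f x * h x) = ((EFin \o h) \* (EFin \o f))%E.
  by apply/funext => x /=; rewrite mulrC.
apply: integrableMr => //; first exact: measurable_funTS.
exists M; split; first exact: num_real.
by move=> N MN x _; apply: le_trans (hM x) (ltW MN).
Qed.

Lemma integrable_funB l f g : mu.-integrable `]0, l[ (EFin \o f) ->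
  mu.-integrable `]0, l[ (EFin \o g) ->
  mu.-integrable `]0, l[ (EFin \o (fun x => f x - g x)).
Proof. by move=> i1 i2; apply: (integrableB _ i1 i2). Qed.

Lemma integrable_funD l f g : mu.-integrable `]0, l[ (EFin \o f) ->
  mu.-integrable `]0, l[ (EFin \o g) ->
  mu.-integrable `]0, l[ (EFin \o (fun x => f x + g x)).
Proof. by move=> i1 i2; apply: (integrableD _ i1 i2). Qed.

Lemma integrable_funZ l (k : R) f : mu.-integrable `]0, l[ (EFin \o f) ->
  mu.-integrable `]0, l[ (EFin \o (fun x => k * f x)).
Proof. by move=> i1; apply: (integrableZl _ k i1). Qed.

Lemma integral_tent l a e : 0 < a -> a + e < l -> 0 < e ->
  \int[mu]_(x in `]0, l[) (e^-1 * tent ((x - a) / e)) = 1.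
Proof.
move=> a0 ael e0.
have l0 : 0 < l by lra.
have cT := @continuous_tent_scaled R a e.
have cT' : {within `[0, l], continuous (fun x => e^-1 * tent ((x - a) / e))}.
  exact: continuous_subspaceT.
have iT : mu.-integrable `[0, l] (EFin \o (fun x => e^-1 * tent ((x - a) / e))).
  by apply: continuous_compact_integrable => //; exact: segment_compact.
rewrite Rintegral_itv_bndo_bndc; last first.
  by apply: integrableS iT => //; exact: subset_itv_oo_cc.
rewrite Rintegral_itv_obnd_cbnd; last first.
  by apply: integrableS iT => //; exact: subset_itv_oc_cc.
rewrite /Rintegral.
rewrite (@continuous_FTC2 _ _ (fun x => step ((x - a) / e))) //=.
- rewrite step_ge1 ?step_le0 ?subr0//.
    by rewrite sub0r mulNr oppr_le0 divr_ge0// ltW.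
  by rewrite ler_pdivlMr// mul1r; lra.
- have cs : continuous (fun x => step ((x - a) / e)).
    by apply: is_derive_continuous => x; exact: is_derive_step_scaled.
  split.
  + by move=> x _; have [] := is_derive_step_scaled a e x.
  + by apply: cvg_at_right_filter; exact: cs.
  + by apply: cvg_at_left_filter; exact: cs.
- move=> x _; rewrite derive1E.
  by have [] := is_derive_step_scaled a e x.
Qed.

(** As [tent] has mass 1 and is bounded by 2, the error of the weighted mean is
    at most (2 / e) times the integral of |f - f a| over the ball of radius e,
    that is, 4 times the average of |f - f a| over this ball. *)
Lemma tent_average l f a e : mu.-integrable `]0, l[ (EFin \o f) ->
  0 < e -> 0 < a - e -> a + e < l ->
  (`| \int[mu]_(x in `]0, l[) (f x * (e^-1 * tent ((x - a) / e))) - f a |%:E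
    <= 4%:E * davg (f \_ `]0%R, l[) a e)%E.
Proof.
move=> intf e0 ae0 ael; have a0 : 0 < a by lra.
have mD : measurable `]0, l[%classic by exact: measurable_itv.
set T := fun x => e^-1 * tent ((x - a) / e).
have mT : measurable_fun setT T.
  apply: continuous_measurable_fun; exact: continuous_tent_scaled.
have T0 x : 0 <= T x.
  by rewrite mulr_ge0 ?invr_ge0 ?(ltW e0)//; case/andP: (tent_bound ((x-a)/e)).
have T2 x : T x <= e^-1 * 2.
  by rewrite ler_wpM2l ?invr_ge0 ?(ltW e0)//; case/andP: (tent_bound ((x-a)/e)).
have TM x : `|T x| <= e^-1 * 2 by rewrite ger0_norm.
have Tout x : x \notin (ball a e : set R) -> T x = 0.
  rewrite notin_setE /ball/= => /negP; rewrite -leNgt => h.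
  rewrite /T tent_out ?mulr0//.
  have [ax|xa] := leP a x.
    rewrite distrC ger0_norm ?subr_ge0// in h.
    by rewrite [X in _ || X]ler_pdivlMr// mul1r h orbT.
  by rewrite ler_pdivrMr// mul0r subr_le0 (ltW xa).
have i1 := integrableM_le mT TM intf.
have mbnd : (mu `]0%R, l[%classic < +oo)%E.
  by rewrite lebesgue_measure_itv/=; case: ifP => // _; rewrite -EFinB ltry.
have ic : mu.-integrable `]0, l[ (EFin \o (fun=> f a)).
  apply: measurable_bounded_integrable => //.
  by exists `|f a|; split; [exact: num_real|move=> M ? x _; exact: ltW].
have i2 := integrableM_le mT TM ic.
have -> : \int[mu]_(x in `]0, l[) (f x * T x) - f a =
    \int[mu]_(x in `]0, l[) ((f x - f a) * T x).
  rewrite -{1}[f a]mulr1 -(integral_tent a0 ael e0) -RintegralZl//.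
    rewrite -RintegralB//; apply: eq_Rintegral => x _; rewrite /T; ring.
  have ic1 : mu.-integrable `]0, l[ (EFin \o (fun=> 1 : R)).
    apply: measurable_bounded_integrable => //.
    by exists 1; split; [exact: num_real|move=> M ? x _; rewrite normr1 ltW].
  have := integrableM_le mT TM ic1.
  by congr (_.-integrable _ _); apply/funext => x /=; rewrite mul1r.
have i3 : mu.-integrable `]0, l[ (EFin \o (fun x => (f x - f a) * T x)).
  have := integrable_funB i1 i2.
  by congr (_.-integrable _ _); apply/funext => x /=; rewrite mulrBl.
rewrite EFin_normr_Rintegral//.
apply: le_trans.
  by apply: le_abse_integral => //; case/integrableP : i3.
have mf : measurable_fun `]0, l[ f by apply/measurable_EFinP; case/integrableP : intf.
have bD : ball a e `<=` `]0, l[%classic.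
  move=> x; rewrite /ball/= ltr_distl in_itv/= => /andP[h1 h2].
  by apply/andP; split; lra.
have mball : measurable (ball a e : set R) by exact: measurable_ball.
have -> : (4%:E * davg (f \_ `]0%R, l[) a e =
    \int[mu]_(x in `]0%R, l[) ((e^-1 * 2)%:E * ((fun x => `|f x - f a|%:E) \_ (ball a e)) x))%E.
  rewrite ge0_integralZl//=; last 3 first.
  - apply/(measurable_restrict _ _ _) => //.
    rewrite setIidr//; apply/measurable_EFinP; apply: measurableT_comp => //.
    apply: measurable_funB => //; exact: measurable_funS mf.
  - by move=> x _; rewrite patchE; case: ifP => _//; rewrite lee_fin.
  - by rewrite lee_fin mulr_ge0// invr_ge0 ltW.
  rewrite -integral_mkcondr setIidr// /davg /iavg.
  rewrite lebesgue_measure_ball ?(ltW e0)// inver mulrn_eq0/= gt_eqF//.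
  rewrite muleA -EFinM; congr (_%:E * _)%E.
    by rewrite -mulr_natl; field; rewrite gt_eqF.
  apply: eq_integral => x; rewrite inE => xb /=.
  rewrite !patchE !mem_set//=; last exact: bD.
  by rewrite in_itv/=; apply/andP; split; lra.
apply: ge0_le_integral => //=.
- apply/measurable_EFinP; apply: measurableT_comp => //.
  by apply/measurable_EFinP; case/integrableP: i3.
- apply: measurable_funeM; apply/(measurable_restrict _ _ _) => //.
    rewrite setIidr//; apply/measurable_EFinP; apply: measurableT_comp => //.
    apply: measurable_funB => //; exact: measurable_funS mf.
move=> x _; rewrite patchE; case: ifPn => xb.
  by rewrite -EFinM lee_fin normrM mulrC ler_wpM2r// ger0_norm.
by rewrite Tout// mulr0 normr0 mule0.
Qed.

(** Differences of two steps are compactly supported, and their derivative is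
    an approximate Dirac mass at [a] minus one at [b]: this is what evaluates
    both sides of the definition of a weak derivative. *)
Lemma test_function_step l a b e : 0 < a -> 0 < b -> 0 < e -> a + e < l ->
  b + e < l ->
  let phi := fun x => step ((x - a) / e) - step ((x - b) / e) in
  test_function l phi /\
  derive1 phi = (fun x => e^-1 * tent ((x - a) / e) - e^-1 * tent ((x - b) / e)).
Proof.
move=> a0 b0 e0 ael bel phi.
have D x : is_derive x 1 phi
    (e^-1 * tent ((x - a) / e) - e^-1 * tent ((x - b) / e)).
  have D1 := is_derive_step_scaled a e x; have D2 := is_derive_step_scaled b e x.
  exact: is_deriveB.
have E : derive1 phi =
    (fun x => e^-1 * tent ((x - a) / e) - e^-1 * tent ((x - b) / e)).
  by apply/funext => x; rewrite derive1E; have [] := D x.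
split=> //; split.
- by move=> x; have [] := D x.
- by rewrite E => x; apply: cvgB; exact: continuous_tent_scaled.
- have xa c x : x <= c -> step ((x - c) / e) = 0.
    by move=> xc; rewrite step_le0// ler_pdivrMr// mul0r subr_le0.
  have xb c x : c + e <= x -> step ((x - c) / e) = 1.
    by move=> xc; rewrite step_ge1// ler_pdivlMr// mul1r lerBrDl.
  exists (Num.min a b), (Num.max a b + e); split.
  + by rewrite lt_min a0 b0.
  + by case: (leP a b) => ab; lra.
  + by case: (leP a b) => ab; lra.
  + move=> x; rewrite in_itv/= negb_and -!ltNge => /orP[|].
      by rewrite lt_min => /andP[/ltW xxa /ltW xxb]; rewrite /phi !xa ?subrr.
    rewrite -ltrBrDr gt_max => /andP[h1 h2].
    by rewrite /phi !xb ?subrr// -lerBrDr ltW.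
Qed.

(** Dominated convergence: the steps are bounded by 1 and converge to the
    indicator of the half-line beyond [a]. *)
Lemma cvg_step_average l a g : mu.-integrable `]0, l[ (EFin \o g) ->
  (\int[mu]_(x in `]0, l[) (g x * step ((x - a) / n.+1%:R^-1))) @[n --> \oo] -->
  \int[mu]_(x in `]0, l[ `&` `]a, +oo[) g x.
Proof.
move=> intg.
have mD : measurable `]0, l[%classic by exact: measurable_itv.
have ms n : measurable_fun setT (fun x => step ((x - a) / n.+1%:R^-1)).
  apply: continuous_measurable_fun; apply: is_derive_continuous => x.
  exact: is_derive_step_scaled.
have sM n x : `|step ((x - a) / n.+1%:R^-1)| <= 1 by exact: step_bound.
have ig n := integrableM_le (ms n) (sM n) intg.
have mg : measurable_fun `]0, l[ g by apply/measurable_EFinP; case/integrableP : intg.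
have [//|||||ilim _ cvlim] := @dominated_convergence _ _ R mu `]0, l[%classic mD
  (fun n x => (g x * step ((x - a) / n.+1%:R^-1))%:E)
  (fun x => ((g \_ `]a, +oo[) x)%:E) (fun x => `|g x|%:E).
- by move=> n; case/integrableP : (ig n).
- apply/measurable_EFinP; apply/(measurable_restrict _ _ _) => //.
  by apply: measurable_funS mg => //; exact: subIsetl.
- apply: aeW => x xD; apply: cvg_EFin; first by near=> n.
  rewrite patchE; case: ifPn => [|xa].
    rewrite inE/= in_itv/= andbT => ax.
    have xa0 : 0 < x - a by rewrite subr_gt0.
    apply/cvgrPdist_lt => eps eps0; near=> n.
    rewrite /= step_ge1 ?mulr1 ?subrr ?normr0//.
    rewrite ler_pdivlMr ?invr_gt0// mul1r.
    apply: ltW; near: n; exact: (near_infty_natSinv_lt (PosNum xa0)).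
  have {}xa : x <= a.
    by move: xa; rewrite notin_setE/= in_itv/= andbT => /negP; rewrite -leNgt.
  apply/cvgrPdist_lt => eps eps0; near=> n.
  rewrite /= step_le0 ?mulr0 ?subrr ?normr0//.
  by rewrite invrK pmulr_lle0// subr_le0.
- by move/integrable_abse : intg; apply: eq_integrable.
- apply: aeW => x n xD.
  by rewrite lee_fin normrM ler_piMr.
rewrite Rintegral_mkcondr.
by apply/fine_cvg; rewrite fineK// integrable_fin_num.
Unshelve. all: by end_near. Qed.

Lemma cvg_tent_average l a f : 0 < a -> a < l ->
  mu.-integrable `]0, l[ (EFin \o f) -> lebesgue_pt (f \_ `]0, l[) a ->
  (\int[mu]_(x in `]0, l[)
     (f x * (n.+1%:R * tent ((x - a) / n.+1%:R^-1)))) @[n --> \oo] --> f a.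
Proof.
move=> a0 al intf lpt; apply/cvgrPdist_lt => eps eps0.
have : \forall e \near 0^'+,
    `| \int[mu]_(x in `]0, l[) (f x * (e^-1 * tent ((x - a) / e))) - f a | < eps.
  have : \forall e \near 0^'+, (davg (f \_ `]0%R, l[) a e < (eps / 4)%:E)%E.
    move/fine_cvgP : lpt => [fin /cvgrPdist_lt/(_ (eps/4))]/(_ _)[|].
      by rewrite divr_gt0.
    near_simpl; move=> d d0 H; near=> e.
    have fe : davg (f \_ `]0%R, l[) a e \is a fin_num by near: e.
    rewrite -(fineK fe) lte_fin.
    have /H : ball_ (fun x => `|x|) 0 d e.
      rewrite /ball_/= sub0r normrN gtr0_norm.
        by near: e; exact: nbhs_right_lt.
      by near: e; exact: nbhs_right_gt.
    move=> /(_ _)/=; rewrite sub0r normrN => h.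
    apply: le_lt_trans (ler_norm _) (h _).
    by near: e; exact: nbhs_right_gt.
  move=> H; near=> e.
  have e0 : 0 < e by near: e; exact: nbhs_right_gt.
  have ea : e < a by near: e; exact: nbhs_right_lt.
  have el : e < l - a by near: e; apply: nbhs_right_lt; rewrite subr_gt0.
  rewrite -lte_fin; apply: le_lt_trans (tent_average intf e0 _ _) _; [lra|lra|].
  have : (davg (f \_ `]0%R, l[) a e < (eps / 4)%:E)%E by near: e.
  have -> : eps%:E = (4%:E * (eps / 4)%:E)%E by rewrite -EFinM mulrC divfK.
  by rewrite lte_pmul2l.
move=> [d /= d0 H]; near=> n.
rewrite distrC.
have nd : n.+1%:R^-1 < d.
  near: n; exact: (near_infty_natSinv_lt (PosNum d0)).
have := H (n.+1%:R^-1); rewrite /ball_/= sub0r normrN gtr0_norm ?invr_gt0// => /(_ nd).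
by rewrite invrK; apply => //; rewrite invr_gt0.
Unshelve. all: by end_near. Qed.

(** The du Bois-Reymond lemma. Testing with the difference of the steps at two
    Lebesgue points a and b of f gives, in the limit,
    f a - f b = - (integral of g beyond a) + (integral of g beyond b), so that
    f plus the tail integral of g takes the same value at almost every point. *)
Lemma weak_deriv_repr l f g : 0 < l ->
  mu.-integrable `]0, l[ (EFin \o f) -> mu.-integrable `]0, l[ (EFin \o g) ->
  (forall phi, test_function l phi ->
     \int[mu]_(x in `]0, l[) (f x * derive1 phi x) =
     - \int[mu]_(x in `]0, l[) (g x * phi x)) ->
  exists c, {ae mu, forall x, x \in `]0, l[ ->
    f x = c - \int[mu]_(t in `]0, l[ `&` `]x, +oo[) g t}.
Proof.
move=> l0 intf intg hw.
pose W x := \int[mu]_(t in `]0, l[ `&` `]x, +oo[) g t.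
have mD : measurable `]0, l[%classic by exact: measurable_itv.
have ms a n : measurable_fun setT (fun x => step ((x - a) / n.+1%:R^-1)).
  apply: continuous_measurable_fun; apply: is_derive_continuous => x.
  exact: is_derive_step_scaled.
have sM a n x : `|step ((x - a) / n.+1%:R^-1)| <= 1 by exact: step_bound.
have mt a n : measurable_fun setT (fun x => n.+1%:R * tent ((x - a) / n.+1%:R^-1)).
  have := @continuous_tent_scaled R a n.+1%:R^-1; rewrite invrK.
  exact: continuous_measurable_fun.
have tM a n x : `|n.+1%:R * tent ((x - a) / n.+1%:R^-1)| <= n.+1%:R * 2.
  have /andP[h1 h2] := tent_bound ((x - a) / n.+1%:R^-1).
  by rewrite ger0_norm ?mulr_ge0// ler_wpM2l.
have key a b : a \in `]0, l[ -> b \in `]0, l[ ->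
    lebesgue_pt (f \_ `]0, l[) a -> lebesgue_pt (f \_ `]0, l[) b ->
    f a - f b = W b - W a.
  move=> /[!in_itv]/= /andP[a0 al] /andP[b0 bl] la lb.
  have ca := cvg_tent_average a0 al intf la.
  have cb := cvg_tent_average b0 bl intf lb.
  have wa := cvg_step_average (a := a) intg.
  have wb := cvg_step_average (a := b) intg.
  have /(_ _) c1 := cvgB ca cb; have /(_ _) c2 := cvgB wb wa.
  rewrite -(cvg_lim _ c1); last exact: Rhausdorff.
  apply: cvg_lim; first exact: Rhausdorff.
  apply: cvg_trans c2; apply: near_eq_cvg; near=> n.
  have na : a + n.+1%:R^-1 < l.
    rewrite -ltrBrDl; near: n.
    have h : 0 < l - a by rewrite subr_gt0.
    exact: (near_infty_natSinv_lt (PosNum h)).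
  have nb : b + n.+1%:R^-1 < l.
    rewrite -ltrBrDl; near: n.
    have h : 0 < l - b by rewrite subr_gt0.
    exact: (near_infty_natSinv_lt (PosNum h)).
  have n0 : 0 < n.+1%:R^-1 :> R by rewrite invr_gt0.
  have [tf E] := test_function_step a0 b0 n0 na nb.
  have := hw _ tf; rewrite E.
  have -> : \int[mu]_(x in `]0, l[) (f x * (n.+1%:R^-1^-1 * tent ((x - a) / n.+1%:R^-1)
        - n.+1%:R^-1^-1 * tent ((x - b) / n.+1%:R^-1))) =
      \int[mu]_(x in `]0, l[) (f x * (n.+1%:R * tent ((x - a) / n.+1%:R^-1))) -
      \int[mu]_(x in `]0, l[) (f x * (n.+1%:R * tent ((x - b) / n.+1%:R^-1))).
    rewrite -RintegralB//; [|exact: integrableM_le (tM _ _) intf..].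
    by apply: eq_Rintegral => x _; rewrite !invrK mulrBr.
  have -> : \int[mu]_(x in `]0, l[) (g x * (step ((x - a) / n.+1%:R^-1)
        - step ((x - b) / n.+1%:R^-1))) =
      \int[mu]_(x in `]0, l[) (g x * step ((x - a) / n.+1%:R^-1)) -
      \int[mu]_(x in `]0, l[) (g x * step ((x - b) / n.+1%:R^-1)).
    rewrite -RintegralB//; [|exact: integrableM_le (sM _ _) intg..].
    by apply: eq_Rintegral => x _; rewrite mulrBr.
  by rewrite opprB => h; symmetry; exact: h.
have aeL : {ae mu, forall x, lebesgue_pt (f \_ `]0, l[) x}.
  by apply: lebesgue_differentiation; exact: integrable_locally.
have [a aD la] : exists2 a, a \in `]0, l[ & lebesgue_pt (f \_ `]0, l[) a.
  by apply: ae_itv_exists => //; apply: ae_mono aeL.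
exists (f a + W a); apply: ae_mono aeL => x lx xD.
have := key _ _ xD aD lx la; rewrite -/(W x); lra.
Unshelve. all: by end_near. Qed.

End Repr.

(** * From weak to classical derivatives *)

Section Classical.
Context {R : realType}.
Notation mu := (@lebesgue_measure R).
Implicit Types (a b c e l t x : R) (f g h k : R -> R).

Let mD l : measurable `]0, l[%classic. Proof. exact: measurable_itv. Qed.

(** If the functions differed at an interior point they would differ on a ball,
    which is not negligible; the end points follow by one-sided limits. *)
Lemma within_itv_eq l h k : 0 < l ->
  {within `[0, l], continuous h} -> {within `[0, l], continuous k} ->
  {ae mu, forall x, x \in `]0, l[ -> h x = k x} ->
  forall x, x \in `[0, l] -> h x = k x.
Proof.
move=> l0 ch ck hk.
have oo x : x \in `]0, l[ -> h x = k x.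
  move=> xD; apply/eqP; rewrite -subr_eq0; apply/negP => /negP hk0.
  have xcc : x \in `[0, l] by apply: subset_itv_oo_cc xD.
  have chx : {for x, continuous h}.
    by move: ch => /continuous_within_itvP -/(_ l0)[+ _ _]; exact.
  have ckx : {for x, continuous k}.
    by move: ck => /continuous_within_itvP -/(_ l0)[+ _ _]; exact.
  have ne : \forall y \near x, h y - k y != 0.
    have /(_ _) c := cvgB chx ckx.
    exact: (cvgr_neq0 _ c hk0).
  have nD : \forall y \near x, y \in `]0, l[ by exact: near_in_itvoo.
  have [d /= d0 H] : \forall y \near x, (y \in `]0, l[) && (h y - k y != 0).
    by near=> y; apply/andP; split; near: y.
  have xd : x - d < x + d by lra.
  suff /(ae_itv_exists xd)[] : {ae mu, forall y, y \in `]x - d, x + d[ -> False} by [].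
  apply: ae_mono hk => y yhk yd.
  have /H/andP[yD] : ball_ (fun x => `|x|) x d y.
    by move: yd; rewrite /ball_/= in_itv/= ltr_distlC.
  by rewrite yhk// subrr eqxx.
have [_ h0 hl] := (continuous_within_itvP h l0).1 ch.
have [_ k0 kl] := (continuous_within_itvP k l0).1 ck.
move=> x; rewrite in_itv/= le_eqVlt => /andP[/predU1P[<- _|x0]].
  rewrite -(cvg_lim _ h0)//; apply: cvg_lim => //.
  apply: cvg_trans k0; apply: near_eq_cvg; near=> y.
  by apply/esym/oo; rewrite in_itv/=; apply/andP; split; near: y;
    [exact: nbhs_right_gt|exact: nbhs_right_lt].
rewrite le_eqVlt => /predU1P[->|xl].
  rewrite -(cvg_lim _ hl)//; apply: cvg_lim => //.
  apply: cvg_trans kl; apply: near_eq_cvg; near=> y.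
  by apply/esym/oo; rewrite in_itv/=; apply/andP; split; near: y;
    [exact: nbhs_left_gt|exact: nbhs_left_lt].
by apply: oo; rewrite in_itv/= x0.
Unshelve. all: by end_near. Qed.

(** The integrand is extended by zero so that integrability on the open interval
    is enough to integrate it over closed ones. *)
Definition primitive l g x := \int[mu]_(t in `[0, x]) (g \_ `]0, l[) t.

Lemma integrable_restr l g (A : set R) : measurable A ->
  mu.-integrable `]0, l[ (EFin \o g) ->
  mu.-integrable A (EFin \o (g \_ `]0, l[)).
Proof.
move=> mA intg; rewrite -restrict_EFin; apply/integrable_restrict => //.
by apply: integrableS intg => //; exact: measurableI.
Qed.

Lemma primitive_continuous l g : 0 < l -> mu.-integrable `]0, l[ (EFin \o g) ->
  {within `[0, l], continuous (primitive l g)}.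
Proof.
move=> l0 intg; apply: parameterized_integral_continuous; first exact: ltW.
exact: integrable_restr.
Qed.

(** The Lebesgue differentiation theorem, for the primitive of an integrable
    function. *)
Lemma primitive_ae_deriv l g : 0 < l -> mu.-integrable `]0, l[ (EFin \o g) ->
  {ae mu, forall x, x \in `]0, l[ -> derive1 (primitive l g) x = g x}.
Proof.
move=> l0 intg.
have := @FTC1 R (g \_ `]0, l[) (BLeft 0).
move=> /(_ _ (integrable_locally (mD l) intg)) H.
have {}H := H (fun y => integrable_restr (measurable_itv _) intg).
apply: ae_mono H => x /= + xD.
have x0 : 0 < x by move: xD; rewrite in_itv => /andP[].
rewrite lte_fin => /(_ x0)[_ ->].
by rewrite patchE mem_set.
Qed.

Lemma primitive_deriv l g k : 0 < l -> mu.-integrable `]0, l[ (EFin \o g) ->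
  {within `[0, l], continuous k} -> {ae mu, forall x, x \in `]0, l[ -> g x = k x} ->
  forall x, x \in `]0, l[ -> is_derive x 1 (primitive l g) (k x).
Proof.
move=> l0 intg ck gk x xD.
have ik : mu.-integrable `[0, l] (EFin \o k).
  by apply: continuous_compact_integrable => //; exact: segment_compact.
have mk : measurable_fun `]0, l[ k.
  apply/measurable_EFinP; case/integrableP: ik => mk _.
  by apply: measurable_funS mk => //; exact: subset_itv_oo_cc.
have mg : measurable_fun `]0, l[ g.
  by apply/measurable_EFinP; case/integrableP : intg.
have primE : primitive l g = primitive l k.
  apply/funext => y; rewrite /primitive /Rintegral; congr fine.
  apply: ae_eq_integral => //.
  - apply/measurable_EFinP; apply/(measurable_restrict _ _ _) => //.
    by apply: measurable_funS mg => //; exact: subIsetr.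
  - apply/measurable_EFinP; apply/(measurable_restrict _ _ _) => //.
    by apply: measurable_funS mk => //; exact: subIsetr.
  apply: ae_mono gk => t gkt _; rewrite !patchE.
  by case: ifPn => // /set_mem tD; rewrite gkt.
have [x0 xl] : 0 < x /\ x < l by move: xD; rewrite in_itv => /andP[].
have ik' : mu.-integrable `]0, l[ (EFin \o k).
  by apply: integrableS ik => //; exact: subset_itv_oo_cc.
have ckx : {for x, continuous k}.
  by move: ck => /continuous_within_itvP -/(_ l0)[+ _ _]; exact.
have ckx' : {for x, continuous (k \_ `]0, l[)}.
  rewrite /prop_for /continuous_at patchE mem_set//.
  apply: cvg_trans ckx; apply: near_eq_cvg; near=> y.
  rewrite patchE mem_set//=; near: y; exact: near_in_itvoo.
have := @continuous_FTC1_closed R (k \_ `]0, l[) 0 x l xl.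
move=> /(_ (integrable_restr (measurable_itv _) ik') x0 ckx')[d1 d2].
rewrite primE; split; first exact: d1.
by rewrite -derive1E d2 patchE mem_set.
Unshelve. all: by end_near. Qed.

Lemma weak_primitive l f g : 0 < l ->
  mu.-integrable `]0, l[ (EFin \o f) -> mu.-integrable `]0, l[ (EFin \o g) ->
  (forall phi, test_function l phi ->
     \int[mu]_(x in `]0, l[) (f x * derive1 phi x) =
     - \int[mu]_(x in `]0, l[) (g x * phi x)) ->
  exists c, {ae mu, forall x, x \in `]0, l[ -> f x = c + primitive l g x}.
Proof.
move=> l0 intf intg /(weak_deriv_repr l0 intf intg)[c H].
exists (c - \int[mu]_(t in `[0, l]) (g \_ `]0, l[) t).
apply: ae_mono H => x + xD => -> //.
rewrite -addrA; congr (c + _).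
have [x0 xl] : 0 < x /\ x < l by move: xD; rewrite in_itv => /andP[].
have := @Rintegral_itvB R (g \_ `]0, l[) (BLeft 0) (BRight l) x.
move=> /(_ (integrable_restr (measurable_itv _) intg)).
rewrite !bnd_simp => /(_ (ltW x0) (ltW xl)) h.
rewrite /primitive addrC -opprB h; congr (- _).
rewrite setIC Rintegral_mkcondr.
rewrite Rintegral_mkcond [RHS]Rintegral_mkcond; apply: eq_Rintegral => t _.
rewrite !patchE /=; case: ifPn => [|].
  rewrite inE/= in_itv/= andbT => xt.
  case: ifPn => [|h1]; first by rewrite inE/= in_itv/= => /andP[t0 tl]; rewrite mem_set//= in_itv/= xt ltW.
  by case: ifP.
rewrite notin_setE/= in_itv/= andbT => xt.
by rewrite memNset//= in_itv/= => /andP[].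
Qed.

(** By uniqueness of continuous representatives [h] is the constant plus the
    primitive of [g] given by [weak_primitive]; as [g] agrees almost everywhere
    with a continuous function, this primitive is differentiable everywhere. *)
Lemma weak_classical l f g h k : 0 < l ->
  mu.-integrable `]0, l[ (EFin \o f) -> mu.-integrable `]0, l[ (EFin \o g) ->
  (forall phi, test_function l phi ->
     \int[mu]_(x in `]0, l[) (f x * derive1 phi x) =
     - \int[mu]_(x in `]0, l[) (g x * phi x)) ->
  {within `[0, l], continuous h} -> {ae mu, forall x, x \in `]0, l[ -> f x = h x} ->
  {within `[0, l], continuous k} -> {ae mu, forall x, x \in `]0, l[ -> g x = k x} ->
  forall x, x \in `]0, l[ -> is_derive x 1 h (k x).
Proof.
move=> l0 intf intg hw ch fh ck gk x xD.
have [c fc] := weak_primitive l0 intf intg hw.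
have cp : {within `[0, l], continuous (fun x => c + primitive l g x)}.
  move=> y; apply: cvgD; first exact: cvg_cst.
  exact: primitive_continuous.
have E : forall y, y \in `[0, l] -> c + primitive l g y = h y.
  apply: within_itv_eq => //; apply: ae_mono2 fc fh => y h1 h2 yD.
  by rewrite -h1// h2.
apply: (@near_eq_is_derive R R^o R^o (fun x => c + primitive l g x)).
  near=> y; apply: E; apply: subset_itv_oo_cc; near: y; exact: near_in_itvoo.
have D := primitive_deriv l0 intg ck gk xD.
by rewrite -[k x]add0r; exact: (is_deriveD (is_derive_cst c x 1) D).
Unshelve. all: by end_near. Qed.

Lemma weak_has_crepr l f g : 0 < l ->
  mu.-integrable `]0, l[ (EFin \o f) -> mu.-integrable `]0, l[ (EFin \o g) ->
  (forall phi, test_function l phi ->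
     \int[mu]_(x in `]0, l[) (f x * derive1 phi x) =
     - \int[mu]_(x in `]0, l[) (g x * phi x)) ->
  exists2 h, {within `[0, l], continuous h} &
             {ae mu, forall x, x \in `]0, l[ -> f x = h x}.
Proof.
move=> l0 intf intg hw; have [c fc] := weak_primitive l0 intf intg hw.
exists (fun x => c + primitive l g x) => // y; apply: cvgD; first exact: cvg_cst.
exact: primitive_continuous.
Qed.

(** The fundamental lemma of the calculus of variations. The hypothesis says that
    [g] is a weak derivative of 0, hence its primitive is constant, and the
    derivative of the primitive is [g] almost everywhere. *)
Lemma test_orthogonal_eq0 l g : 0 < l -> mu.-integrable `]0, l[ (EFin \o g) ->
  (forall phi, test_function l phi -> \int[mu]_(x in `]0, l[) (g x * phi x) = 0) ->
  {ae mu, forall x, x \in `]0, l[ -> g x = 0}.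
Proof.
move=> l0 intg hw.
have i0 : mu.-integrable `]0, l[ (EFin \o cst (0 : R)) by exact: integrable0.
have [phi tphi|c Hc] := weak_primitive l0 i0 intg.
  rewrite hw// oppr0; transitivity (\int[mu]_(x in `]0, l[) (0 : R)).
    by apply: eq_Rintegral => x _; rewrite mul0r.
  by rewrite Rintegral_cst ?mul0r.
have cp : {within `[0, l], continuous (primitive l g)} by exact: primitive_continuous.
have c0 : {within `[0, l], continuous (fun=> - c)} by move=> ?; exact: cvg_cst.
have E := within_itv_eq l0 cp c0.
have {}E : forall x, x \in `[0, l] -> primitive l g x = - c.
  apply: E; apply: ae_mono Hc => x H xD; have := H xD; rewrite /cst; lra.
apply: ae_mono (primitive_ae_deriv l0 intg) => x + xD => <-//.
rewrite derive1E.
suff : is_derive x 1 (primitive l g) 0 by case.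
have D := is_derive_cst (- c) x (1 : R).
apply: (@near_eq_is_derive R R^o R^o (fun _ : R^o => - c : R^o)).
near=> y; rewrite E//; apply: subset_itv_oo_cc; near: y; exact: near_in_itvoo.
Unshelve. all: by end_near. Qed.

Lemma classical_weak l f g : 0 < l -> (forall x, is_derive x 1 f (g x)) ->
  continuous g -> forall phi, test_function l phi ->
     \int[mu]_(x in `]0, l[) (f x * derive1 phi x) =
     - \int[mu]_(x in `]0, l[) (g x * phi x).
Proof.
move=> l0 df cg phi [dphi cphi [a [b [a0 ab bl phi0]]]].
have cf := is_derive_continuous df.
have cph : continuous phi.
  by move=> x; apply: differentiable_continuous; apply/derivable1_diffP.
have icc h : continuous h -> mu.-integrable `[0, l] (EFin \o h).
  move=> ch; apply: continuous_compact_integrable; first exact: segment_compact.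
  exact: continuous_subspaceT.
have oo_cc h : continuous h ->
    \int[mu]_(x in `]0, l[) h x = \int[mu]_(x in `[0, l]) h x.
  move=> ch; rewrite Rintegral_itv_bndo_bndc; last first.
    by apply: integrableS (icc _ ch) => //; exact: subset_itv_oo_cc.
  rewrite Rintegral_itv_obnd_cbnd//.
  by apply: integrableS (icc _ ch) => //; exact: subset_itv_oc_cc.
have dLR h : continuous h -> (forall x, derivable h x 1) ->
    derivable_oo_LRcontinuous h 0 l.
  move=> ch dh; split; first by move=> x _; exact: dh.
  - by apply: cvg_at_right_filter; exact: ch.
  - by apply: cvg_at_left_filter; exact: ch.
rewrite !oo_cc; [|by move=> x; apply: cvgM; [exact: cg|exact: cph]
                 |by move=> x; apply: cvgM; [exact: cf|exact: cphi]].
have df1 : forall x, derivable f x 1 by move=> x; have [] := df x.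
have eg : {in `]0, l[, derive1 f =1 g}.
  by move=> x _; rewrite derive1E; have [] := df x.
have := @Rintegration_by_parts R f phi g (derive1 phi) 0 l l0
  (continuous_subspaceT cg) (dLR f cf df1) eg (continuous_subspaceT cphi)
  (dLR phi cph dphi) (fun _ _ => erefl).
move=> ->; rewrite !phi0 ?mulr0 ?subrr ?sub0r//.
- by rewrite in_itv/= negb_and -!ltNge a0.
- by rewrite in_itv/= negb_and -!ltNge bl orbT.
Qed.

End Classical.

(** * Complex-valued square-integrable functions *)

Section Complex.
Context {R : realType}.
Notation mu := (@lebesgue_measure R).
Implicit Types (l : R) (f g h : cfun R) (w : R[i]) (b : bool).

(** Indexing the two coordinates by a boolean lets every real-valued result be
    transferred to complex-valued functions in a single application. *)
Definition part b w : R := if b then complex.Re w else complex.Im w.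

Lemma part_inj w1 w2 : (forall b, part b w1 = part b w2) -> w1 = w2.
Proof.
case: w1 w2 => [x1 y1] [x2 y2] H.
by have := (H true, H false); rewrite /part /= => -[-> ->].
Qed.

Lemma part0 b : part b 0 = 0. Proof. by case: b. Qed.
Lemma partD b w1 w2 : part b (w1 + w2) = part b w1 + part b w2.
Proof. by case: b w1 w2 => -[? ?] [? ?]. Qed.
Lemma partN b w : part b (- w) = - part b w.
Proof. by case: b w => -[? ?]. Qed.
Lemma partMr b w (r : R) : part b (w * r%:C) = part b w * r.
Proof. by case: b w => -[x y] /=; rewrite !mulr0 ?subr0 ?add0r. Qed.
Lemma partMl b w (r : R) : part b (r%:C * w) = r * part b w.
Proof. by rewrite mulrC partMr mulrC. Qed.
Lemma partM b w1 w2 : part b (w1 * w2) =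
  if b then part true w1 * part true w2 - part false w1 * part false w2
  else part true w1 * part false w2 + part false w1 * part true w2.
Proof. by case: b w1 w2 => -[x y] [x2 y2] /=. Qed.

Lemma cmod_sq w : cmod w ^+ 2 = part true w ^+ 2 + part false w ^+ 2.
Proof.
by case: w => x y; rewrite /cmod /part /= sqr_sqrtr// addr_ge0// sqr_ge0.
Qed.

Lemma cmodM w1 w2 : cmod (w1 * w2) = cmod w1 * cmod w2.
Proof. exact: ComplexField.Normc.normcM. Qed.

Lemma cmod_ge0 w : 0 <= cmod w. Proof. by case: w => x y; exact: sqrtr_ge0. Qed.

Lemma cmod_eq0 w : cmod w = 0 -> w = 0.
Proof. exact: ComplexField.Normc.eq0_normc. Qed.

Lemma cmod0 : cmod (0 : R[i]) = 0. Proof. by rewrite /cmod ComplexField.Normc.normc0. Qed.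

Lemma cmodD_sq w1 w2 : cmod (w1 + w2) ^+ 2 <= 2 * cmod w1 ^+ 2 + 2 * cmod w2 ^+ 2.
Proof.
rewrite !cmod_sq !partD.
have h1 := sqr_ge0 (part true w1 - part true w2).
have h2 := sqr_ge0 (part false w1 - part false w2); nra.
Qed.

Lemma part_le_cmod b w : `|part b w| <= cmod w.
Proof.
rewrite -ler_sqr ?nnegrE ?normr_ge0 ?cmod_ge0// cmod_sq real_normK ?num_real//.
by case: b; rewrite ?lerDl ?lerDr sqr_ge0.
Qed.

Lemma eq_on_refl l f : eq_on l f f. Proof. exact: aeW. Qed.
Lemma eq_on_sym l f g : eq_on l f g -> eq_on l g f.
Proof. by apply: ae_mono => x h xD; rewrite h. Qed.
Lemma eq_on_trans l g f h : eq_on l f g -> eq_on l g h -> eq_on l f h.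
Proof. by apply: ae_mono2 => x h1 h2 xD; rewrite h1// h2. Qed.
Lemma eq_onD l f1 f2 g1 g2 : eq_on l f1 g1 -> eq_on l f2 g2 ->
  eq_on l (f1 + f2) (g1 + g2).
Proof. by apply: ae_mono2 => x h1 h2 xD; rewrite !fctE h1// h2. Qed.
Lemma eq_onN l f1 g1 : eq_on l f1 g1 -> eq_on l (- f1) (- g1).
Proof. by apply: ae_mono => x h1 xD; rewrite !fctE h1. Qed.
Lemma eq_onZ l (a : R[i]) f1 g1 : eq_on l f1 g1 -> eq_on l (a *: f1) (a *: g1).
Proof. by apply: ae_mono => x h1 xD; rewrite !fctE h1. Qed.
Lemma eq_on_part l b f g : eq_on l f g ->
  {ae mu, forall x, x \in `]0, l[ -> part b (f x) = part b (g x)}.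
Proof. by apply: ae_mono => x h1 xD; rewrite h1. Qed.
Lemma part_eq_on l f g :
  (forall b, {ae mu, forall x, x \in `]0, l[ -> part b (f x) = part b (g x)}) ->
  eq_on l f g.
Proof.
move=> H; apply: ae_mono2 (H true) (H false) => x h1 h2 xD.
by apply: part_inj => -[]; [exact: h1|exact: h2].
Qed.

(** The square of the norm of L^2(0, l), which avoids the square roots and
    dispenses with Minkowski's inequality. *)
Definition sqnorm l f : \bar R := (\int[mu]_(x in `]0%R, l[) (cmod (f x) ^+ 2)%:E)%E.

Lemma sqnorm_ge0 l f : (0 <= sqnorm l f)%E.
Proof. by apply: integral_ge0 => x _; rewrite lee_fin sqr_ge0. Qed.

Lemma L2norm_ge0 l f : (0 <= L2norm l f)%E.
Proof. exact: Lnorm_ge0. Qed.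

Lemma L2norm_sq l f : (L2norm l f ^+ 2 = sqnorm l f)%E.
Proof.
have -> : (L2norm l f ^+ 2 = L2norm l f `^ 2)%E.
  have := L2norm_ge0 l f; case: (L2norm l f) => [r| |]//.
    by rewrite lee_fin => r0; rewrite poweR_EFin powR_mulrn.
  by rewrite poweRyr// expe2 mulyy.
rewrite /L2norm poweR_Lnorm// /sqnorm [RHS]integral_mkcond.
apply: eq_integral => x _; rewrite !patchE; case: ifP => _.
  by rewrite poweR_EFin/= powR_mulrn// real_normK// num_real.
by rewrite abse0 poweR0r.
Qed.

Definition meas l f := forall b, measurable_fun `]0, l[ (fun x => part b (f x)).

Lemma inL2P l f : inL2 l f <-> meas l f /\ (sqnorm l f < +oo)%E.
Proof.
have E : (L2norm l f < +oo)%E <-> (sqnorm l f < +oo)%E.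
  rewrite -L2norm_sq; have := L2norm_ge0 l f.
  case: (L2norm l f) => [r| |]// _; by split=> // _; rewrite ltry.
split=> [[m1 m2 /E]|[m /E n]]; first by split=> // -[].
by split=> //; [exact: m true|exact: m false].
Qed.

Lemma inL2_meas l f : inL2 l f -> meas l f. Proof. by move=> /inL2P[]. Qed.

Lemma meas_cmod l f : meas l f ->
  measurable_fun `]0, l[ (fun x => (cmod (f x) ^+ 2)%:E).
Proof.
move=> m; apply/measurable_EFinP.
rewrite (_ : (fun x => _) = (fun x => part true (f x) ^+ 2 + part false (f x) ^+ 2));
  last by apply/funext => x; exact: cmod_sq.
by apply: measurable_funD; apply: measurable_funX; exact: m.
Qed.

Lemma meas_lin l (a : R[i]) f g : meas l f -> meas l g -> meas l (a *: f + g).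
Proof.
move=> mf mg b.
rewrite (_ : (fun x => _) = (fun x => part b (a * f x) + part b (g x)));
  last by apply/funext => x; exact: partD.
apply: measurable_funD; last exact: mg.
rewrite (_ : (fun x => _) = (fun x => if b
    then part true a * part true (f x) - part false a * part false (f x)
    else part true a * part false (f x) + part false a * part true (f x)));
  last by apply/funext => x; exact: partM.
case: b; [apply: measurable_funB|apply: measurable_funD];
  by apply: measurable_funM => //; exact: mf.
Qed.

(** A substitute for the triangle inequality, obtained by integrating
    |a u + v|^2 <= 2 |a|^2 |u|^2 + 2 |v|^2. *)
Lemma sqnorm_lin l (a : R[i]) f g : meas l f -> meas l g ->
  (sqnorm l (a *: f + g) <= (2 * cmod a ^+ 2)%:E * sqnorm l f + 2%:E * sqnorm l g)%E.
Proof.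
move=> mf mg; have mD : measurable `]0, l[%classic by exact: measurable_itv.
rewrite /sqnorm -!ge0_integralZl//=; last first.
- by rewrite lee_fin mulr_ge0// sqr_ge0.
- by move=> x _; rewrite lee_fin sqr_ge0.
- exact: meas_cmod.
- by move=> x _; rewrite lee_fin sqr_ge0.
- exact: meas_cmod.
rewrite -ge0_integralD//=; last first.
- by apply: measurable_funeM; exact: meas_cmod.
- by move=> x _; rewrite -EFinM lee_fin mulr_ge0// sqr_ge0.
- by apply: measurable_funeM; exact: meas_cmod.
- by move=> x _; rewrite -EFinM lee_fin !mulr_ge0// cmod_ge0.
apply: ge0_le_integral => //=.
- by move=> x _; rewrite lee_fin sqr_ge0.
- by apply: meas_cmod; exact: meas_lin.
- by apply: emeasurable_funD; apply: measurable_funeM; exact: meas_cmod.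
move=> x _; rewrite -!EFinM -EFinD lee_fin !fctE.
by apply: le_trans (cmodD_sq _ _) _; rewrite cmodM exprMn mulrA.
Qed.

Lemma inL2_lin l (a : R[i]) f g : inL2 l f -> inL2 l g -> inL2 l (a *: f + g).
Proof.
move=> /inL2P[mf nf] /inL2P[mg ng]; apply/inL2P; split; first exact: meas_lin.
apply: le_lt_trans (sqnorm_lin a mf mg) _.
by apply: lte_add_pinfty; apply: lte_mul_pinfty => //; rewrite lee_fin mulr_ge0// sqr_ge0.
Qed.

Lemma inL20 l : inL2 l 0.
Proof.
apply/inL2P; split=> [b|].
  rewrite (_ : (fun x => _) = cst (0 : R)); first exact: measurable_cst.
  by apply/funext => x; exact: part0.
rewrite /sqnorm (eq_integral (fun=> 0%E)) ?integral0// => x _.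
by rewrite cmod0 expr0n.
Qed.

Lemma inL2Z l (a : R[i]) f : inL2 l f -> inL2 l (a *: f).
Proof. by move=> h; rewrite -[_ *: _]addr0; apply: inL2_lin => //; exact: inL20. Qed.
Lemma inL2D l f g : inL2 l f -> inL2 l g -> inL2 l (f + g).
Proof. by move=> h1 h2; rewrite -[f]scale1r; apply: inL2_lin. Qed.
Lemma inL2N l f : inL2 l f -> inL2 l (- f).
Proof. by move=> h1; rewrite -scaleN1r; exact: inL2Z. Qed.

Lemma eq_sqnorm l f g : meas l f -> meas l g -> eq_on l f g ->
  sqnorm l f = sqnorm l g.
Proof.
move=> mf mg fg; apply: ae_eq_integral => //; try exact: meas_cmod.
by apply: ae_mono fg => x h xD; rewrite h.
Qed.

Lemma sqnorm_eq0 l f : meas l f -> sqnorm l f = 0%E -> eq_on l f 0.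
Proof.
move=> mf; rewrite /sqnorm => s0.
have : ae_eq mu `]0, l[%classic (fun x => (cmod (f x) ^+ 2)%:E) (cst 0%E).
  apply/ae_eq_integral_abs => //; first exact: meas_cmod.
  rewrite -[RHS]s0; apply: eq_integral => x _.
  by rewrite gee0_abs// lee_fin sqr_ge0.
apply: ae_mono => x + xD => /(_ xD) [] /eqP; rewrite sqrf_eq0 => /eqP.
exact: cmod_eq0.
Qed.

(** On a bounded interval, |t| <= 1 + t^2 dominates. *)
Lemma inL2_integrable l b f : inL2 l f ->
  mu.-integrable `]0, l[ (EFin \o (fun x => part b (f x))).
Proof.
move=> /inL2P[mf nf].
have mD : measurable `]0, l[%classic by exact: measurable_itv.
have mlt : (mu `]0%R, l[%classic < +oo)%E.
  by rewrite lebesgue_measure_itv/=; case: ifP => // _; rewrite -EFinB ltry.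
have i1 : mu.-integrable `]0, l[ (fun x => (1 + cmod (f x) ^+ 2)%:E).
  apply: (@integrableD _ _ R mu `]0, l[%classic mD (cst 1%E) (fun x => (cmod (f x) ^+ 2)%:E)).
    apply: (@measurable_bounded_integrable _ _ _ mu (cst 1)) => //.
    by exists 1; split; [exact: num_real|move=> M ? x _; rewrite /= normr1; exact: ltW].
  apply/integrableP; split; first exact: meas_cmod.
  by under eq_integral do rewrite gee0_abs ?lee_fin ?sqr_ge0//.
apply: le_integrable i1 => //; first by apply/measurable_EFinP; exact: mf.
move=> x _ /=; rewrite lee_fin.
apply: le_trans (part_le_cmod b (f x)) _.
have c0 := cmod_ge0 (f x).
rewrite ger0_norm ?addr_ge0 ?sqr_ge0//; nra.
Qed.

End Complex.

(** * Sobolev calculus and traces *)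

Section Sobolev.
Context {R : realType}.
Notation mu := (@lebesgue_measure R).
Implicit Types (l : R) (f g h : cfun R) (w : R[i]) (b : bool).

Lemma part_cintegral l b f :
  part b (cintegral l f) = \int[mu]_(x in `]0, l[) part b (f x).
Proof. by case: b. Qed.

Lemma weak_part l f g : is_weak_deriv l f g <->
  forall b (phi : R -> R), test_function l phi ->
    \int[mu]_(x in `]0, l[) (part b (f x) * derive1 phi x) =
    - \int[mu]_(x in `]0, l[) (part b (g x) * phi x).
Proof.
have E b (u : cfun R) (p : R -> R) :
    part b (cintegral l (fun x => u x * (p x)%:C)) =
    \int[mu]_(x in `]0, l[) (part b (u x) * p x).
  by rewrite part_cintegral; apply: eq_Rintegral => x _; rewrite partMr.
split=> [H b phi tphi|H phi tphi].
  by rewrite -!E -partN; congr part; exact: H.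
by apply: part_inj => b; rewrite partN !E; exact: H.
Qed.

Lemma test_measurable l (phi : R -> R) : test_function l phi ->
  measurable_fun setT phi /\ measurable_fun setT (derive1 phi).
Proof.
move=> [dphi cphi _]; split; apply: continuous_measurable_fun => //.
by move=> x; apply: differentiable_continuous; apply/derivable1_diffP.
Qed.

Lemma compact_support_bounded (a b : R) (phi : R -> R) : a < b ->
  continuous phi -> (forall x, x \notin `[a, b] -> phi x = 0) ->
  exists M : R, forall x, `|phi x| <= M.
Proof.
move=> ab cphi phi0.
have cn : {within `[a, b], continuous (fun x => `|phi x|)}.
  by apply: continuous_subspaceT => x; apply: cvg_norm; exact: cphi.
have [c _ cmax] := EVT_max (ltW ab) cn.
exists `|phi c| => x; have [xab|xab] := boolP (x \in `[a, b]); first exact: cmax.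
by rewrite phi0 ?normr0.
Qed.

Lemma derive1_out (phi : R -> R) (a b : R) :
  (forall x, x \notin `[a, b] -> phi x = 0) ->
  forall x, x \notin `[a, b] -> derive1 phi x = 0.
Proof.
move=> phi0 x xab; rewrite derive1E.
suff : is_derive x 1 phi 0 by case.
have D := is_derive_cst (0 : R) x (1 : R).
apply: (@near_eq_is_derive R R^o R^o (fun _ : R^o => 0 : R^o)).
suff : \forall y \near x, y \notin `[a, b] by apply: filterS => y /phi0 ->.
move: xab; rewrite in_itv/= negb_and -!ltNge => /orP[xa|bx].
  have := lt_nbhsl xa; apply: filterS => y ya.
  by rewrite in_itv/= negb_and -!ltNge ya.
have := lt_nbhsr bx; apply: filterS => y ya.
by rewrite in_itv/= negb_and -!ltNge ya orbT.
Qed.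

Lemma test_bounded l (phi : R -> R) : test_function l phi ->
  exists M : R, (forall x, `|phi x| <= M) /\ (forall x, `|derive1 phi x| <= M).
Proof.
move=> [dphi cphi [a [b [a0 ab bl phi0]]]].
have cph : continuous phi.
  by move=> x; apply: differentiable_continuous; apply/derivable1_diffP.
have [M1 H1] := compact_support_bounded ab cph phi0.
have [M2 H2] := compact_support_bounded ab cphi (derive1_out phi0).
exists (Num.max M1 M2); split=> x; rewrite le_max ?H1 ?H2//.
by rewrite orbT.
Qed.

Lemma eq_on_test l f g (phi : R -> R) b : meas l f -> meas l g -> eq_on l f g ->
  measurable_fun setT phi ->
  \int[mu]_(x in `]0, l[) (part b (f x) * phi x) =
  \int[mu]_(x in `]0, l[) (part b (g x) * phi x).
Proof.
move=> mf mg fg mphi; rewrite /Rintegral; congr fine.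
apply: ae_eq_integral => //.
- apply/measurable_EFinP; apply: measurable_funM; first exact: mf.
  exact: measurable_funTS.
- apply/measurable_EFinP; apply: measurable_funM; first exact: mg.
  exact: measurable_funTS.
- by apply: ae_mono fg => x h xD; rewrite h.
Qed.

Lemma weak_eq_on l f1 f2 g1 g2 : meas l f1 -> meas l f2 -> meas l g1 -> meas l g2 ->
  eq_on l f1 f2 -> eq_on l g1 g2 -> is_weak_deriv l f1 g1 -> is_weak_deriv l f2 g2.
Proof.
move=> mf1 mf2 mg1 mg2 f12 g12 /weak_part H; apply/weak_part => b phi tphi.
have [m1 m2] := test_measurable tphi.
rewrite -(eq_on_test b mf1 mf2 f12 m2) -(eq_on_test b mg1 mg2 g12 m1).
exact: H.
Qed.

Lemma weak_lin l (a : R[i]) f1 f2 g1 g2 : inL2 l f1 -> inL2 l f2 ->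
  inL2 l g1 -> inL2 l g2 ->
  is_weak_deriv l f1 g1 -> is_weak_deriv l f2 g2 ->
  is_weak_deriv l (a *: f1 + f2) (a *: g1 + g2).
Proof.
move=> F1 F2 G1 G2 /weak_part H1 /weak_part H2; apply/weak_part => b phi tphi.
have [m1 m2] := test_measurable tphi.
have [M [b1 b2]] := test_bounded tphi.
have E (u1 u2 : cfun R) (p : R -> R) : inL2 l u1 -> inL2 l u2 ->
    measurable_fun setT p -> (forall x, `|p x| <= M) ->
    \int[mu]_(x in `]0, l[) (part b ((a *: u1 + u2) x) * p x) =
    (if b then part true a * \int[mu]_(x in `]0, l[) (part true (u1 x) * p x)
             - part false a * \int[mu]_(x in `]0, l[) (part false (u1 x) * p x)
     else part true a * \int[mu]_(x in `]0, l[) (part false (u1 x) * p x)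
             + part false a * \int[mu]_(x in `]0, l[) (part true (u1 x) * p x))
    + \int[mu]_(x in `]0, l[) (part b (u2 x) * p x).
  move=> U1 U2 mp bp.
  have i1 c : mu.-integrable `]0, l[ (EFin \o (fun x => part c (u1 x) * p x)).
    exact: integrableM_le mp bp (inL2_integrable c U1).
  have i2 c : mu.-integrable `]0, l[ (EFin \o (fun x => part c (u2 x) * p x)).
    exact: integrableM_le mp bp (inL2_integrable c U2).
  have i3 (k : R) c : mu.-integrable `]0, l[ (EFin \o (fun x => k * (part c (u1 x) * p x))).
    exact: integrable_funZ.
  rewrite -!RintegralZl//; case: b.
    rewrite -RintegralB// -RintegralD//; last exact: integrable_funB.
    apply: eq_Rintegral => x _.
    have -> : (a *: u1 + u2) x = a * u1 x + u2 x by [].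
    rewrite partD partM; ring.
  rewrite -!RintegralD//; last exact: integrable_funD.
  apply: eq_Rintegral => x _.
  have -> : (a *: u1 + u2) x = a * u1 x + u2 x by [].
  rewrite partD partM; ring.
rewrite !E// !H1// !H2//.
by case: ifP => _; ring.
Qed.

(** The difference of two weak derivatives is orthogonal to all test functions. *)
Lemma weak_unique l f g1 g2 : 0 < l -> inL2 l g1 -> inL2 l g2 ->
  is_weak_deriv l f g1 -> is_weak_deriv l f g2 -> eq_on l g1 g2.
Proof.
move=> l0 G1 G2 /weak_part H1 /weak_part H2; apply: part_eq_on => b.
have i1 := inL2_integrable b G1; have i2 := inL2_integrable b G2.
suff : {ae mu, forall x, x \in `]0, l[ -> part b (g1 x) - part b (g2 x) = 0}.
  by apply: ae_mono => x h xD; apply/eqP; rewrite -subr_eq0 h.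
apply: (@test_orthogonal_eq0 R l (fun x => part b (g1 x) - part b (g2 x)) l0) => [|phi tphi].
- exact: integrable_funB.
- have [m1 m2] := test_measurable tphi.
  have [M [b1 b2]] := test_bounded tphi.
  transitivity (\int[mu]_(x in `]0, l[) (part b (g1 x) * phi x) -
     \int[mu]_(x in `]0, l[) (part b (g2 x) * phi x)).
    rewrite -RintegralB//; [|exact: integrableM_le m1 b1 _..].
    by apply: eq_Rintegral => x _; rewrite mulrBl.
  by rewrite -[X in X - _]opprK -H1// -[X in _ - X]opprK -H2// subrr.
Qed.

Lemma weak0 l : is_weak_deriv l (0 : cfun R) 0.
Proof.
move=> phi _.
have E (p : R -> R) : cintegral l (fun x => (0 : cfun R) x * (p x)%:C) = 0.
  apply: part_inj => b; rewrite part_cintegral part0.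
  transitivity (\int[mu]_(x in `]0, l[) (0 : R)).
    by apply: eq_Rintegral => x _; rewrite mul0r part0.
  by rewrite Rintegral_cst ?mul0r.
by rewrite !E oppr0.
Qed.

(** The set from which [wderiv] is chosen is not empty. *)
Lemma wderivP l f g : inL2 l g -> is_weak_deriv l f g ->
  inL2 l (wderiv l f) /\ is_weak_deriv l f (wderiv l f).
Proof.
move=> G H; rewrite /wderiv.
by case: (xgetP 0 [set g | inL2 l g /\ is_weak_deriv l f g]) => [? _ //|/(_ g)];
  case.
Qed.

Lemma wderivE l f g : 0 < l -> inL2 l g -> is_weak_deriv l f g ->
  eq_on l (wderiv l f) g.
Proof.
move=> l0 G H; have [G' H'] := wderivP G H; exact: weak_unique H' H.
Qed.

Lemma inH_L2 l k f : inH l k f -> inL2 l f.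
Proof. by case: k => [[]|k []]. Qed.

(** Almost everywhere equality does not imply measurability for the Borel sets,
    hence the hypothesis that [g] is in L^2. *)
Lemma inH_eq_on l k f g : inH l k f -> inL2 l g -> eq_on l f g -> inH l k g.
Proof.
case: k => [|k] [F H] G fg; split=> //.
have [h [wh Hh]] := H; exists h; split=> //.
have mh := inL2_meas (inH_L2 Hh).
exact: (weak_eq_on (inL2_meas F) (inL2_meas G) mh mh fg (eq_on_refl l h) wh).
Qed.

Lemma inH_wderiv l k f : 0 < l -> inH l k.+1 f ->
  is_weak_deriv l f (wderiv l f) /\ inH l k (wderiv l f).
Proof.
move=> l0 [F [g [wg Hg]]].
have [L W] := wderivP (inH_L2 Hg) wg; split=> //.
apply: (inH_eq_on Hg L); apply: eq_on_sym; apply: wderivE => //.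
exact: inH_L2 Hg.
Qed.

Lemma inH_le l k f : inH l k.+1 f -> inH l k f.
Proof.
elim: k f => [f [F _]|k IH f [F [g [wg Hg]]]]; first by split.
by split=> //; exists g; split=> //; exact: IH.
Qed.

Lemma inH_leq l k m f : (m <= k)%N -> inH l k f -> inH l m f.
Proof.
elim: k => [|k IH]; first by rewrite leqn0 => /eqP ->.
by rewrite leq_eqVlt => /predU1P[->//|mk /inH_le]; exact: IH.
Qed.

Lemma inH_wderivn l k m f : 0 < l -> inH l (m + k) f -> inH l k (wderivn l m f).
Proof.
move=> l0; elim: m k f => [//|m IH] k f H.
rewrite /wderivn iterS.
by have [] := @inH_wderiv l k (wderivn l m f) l0 (IH _ _ _); [rewrite addnS|].
Qed.

Lemma inH_lin l k (a : R[i]) f g : inH l k f -> inH l k g -> inH l k (a *: f + g).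
Proof.
elim: k f g => [|k IH] f g [F H] [G K]; split=> //; [exact: inL2_lin..|].
have [f1 [w1 h1]] := H; have [g1 [w2 h2]] := K.
exists (a *: f1 + g1); split; last exact: IH.
exact: (weak_lin a F G (inH_L2 h1) (inH_L2 h2) w1 w2).
Qed.

Lemma inH0 l k : inH l k (0 : cfun R).
Proof.
elim: k => [|k IH]; split=> //; try exact: inL20.
by exists 0; split=> //; exact: weak0.
Qed.

Lemma inHZ l k (a : R[i]) f : inH l k f -> inH l k (a *: f).
Proof. by move=> h; rewrite -[_ *: _]addr0; apply: inH_lin => //; exact: inH0. Qed.

Lemma wderiv_lin l (a : R[i]) f g : 0 < l -> inH l 1 f -> inH l 1 g ->
  eq_on l (wderiv l (a *: f + g)) (a *: wderiv l f + wderiv l g).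
Proof.
move=> l0 Hf Hg.
have [w1 h1] := inH_wderiv l0 Hf; have [w2 h2] := inH_wderiv l0 Hg.
apply: wderivE => //; first by apply: inL2_lin; [exact: inH_L2 h1|exact: inH_L2 h2].
exact: (weak_lin a (inH_L2 Hf) (inH_L2 Hg) (inH_L2 h1) (inH_L2 h2) w1 w2).
Qed.

Lemma wderiv_eq_on l f g : 0 < l -> inH l 1 f -> inL2 l g -> eq_on l f g ->
  eq_on l (wderiv l f) (wderiv l g).
Proof.
move=> l0 Hf G fg.
have Hg := inH_eq_on Hf G fg.
have [w1 h1] := inH_wderiv l0 Hf; have [w2 h2] := inH_wderiv l0 Hg.
have L1 := inH_L2 h1; have L2 := inH_L2 h2.
apply: (wderivE l0 L2).
exact: (weak_eq_on (inL2_meas G) (inL2_meas (inH_L2 Hf)) (inL2_meas L2)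
  (inL2_meas L2) (eq_on_sym fg) (eq_on_refl l (wderiv l g)) w2).
Qed.

(** Integrals against test functions do not distinguish measurable functions that
    are equal almost everywhere. *)
Lemma wderivn_eq_on l k f g : 0 < l -> inH l k f -> inL2 l g -> eq_on l f g ->
  eq_on l (wderivn l k f) (wderivn l k g).
Proof.
move=> l0; elim: k f g => [//|k IH] f g Hf G fg.
have Hg := inH_eq_on Hf G fg.
rewrite /wderivn !iterSr; apply: IH.
- by have [] := inH_wderiv l0 Hf.
- by have [_ /inH_L2] := inH_wderiv l0 Hg.
- by apply: wderiv_eq_on => //; exact: inH_leq Hf.
Qed.

Lemma wderivn_lin l k (a : R[i]) f g : 0 < l -> inH l k f -> inH l k g ->
  eq_on l (wderivn l k (a *: f + g)) (a *: wderivn l k f + wderivn l k g).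
Proof.
move=> l0; elim: k f g => [|k IH] f g Hf Hg; first exact: eq_on_refl.
have [_ h1] := inH_wderiv l0 Hf; have [_ h2] := inH_wderiv l0 Hg.
rewrite /wderivn !iterSr; apply: eq_on_trans (IH _ _ h1 h2).
apply: wderivn_eq_on => //.
- by have [] := inH_wderiv l0 (inH_lin a Hf Hg).
- by apply: inL2_lin; [exact: inH_L2 h1|exact: inH_L2 h2].
- by apply: wderiv_lin => //; [exact: inH_leq Hf|exact: inH_leq Hg].
Qed.

Lemma wderivn0 l k : 0 < l -> eq_on l (wderivn l k (0 : cfun R)) 0.
Proof.
move=> l0; elim: k => [|k IH]; first exact: eq_on_refl.
rewrite /wderivn iterSr; apply: eq_on_trans IH; apply: eq_on_sym.
apply: wderivn_eq_on => //; first exact: inH0.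
- by have [] := wderivP (inL20 l) (@weak0 l).
- by apply: eq_on_sym; apply: wderivE; [|exact: inL20|exact: weak0].
Qed.

Definition cts_on l h := forall b, {within `[0, l], continuous (fun x => part b (h x))}.

Lemma cts_on_eq l h k : 0 < l -> cts_on l h -> cts_on l k -> eq_on l h k ->
  forall x, x \in `[0, l] -> h x = k x.
Proof.
move=> l0 ch ck hk x xD; apply: part_inj => b.
exact: (within_itv_eq l0 (ch b) (ck b) (eq_on_part b hk) xD).
Qed.

Lemma crepr_of l f h : cts_on l h -> eq_on l f h ->
  cts_on l (crepr l f) /\ eq_on l f (crepr l f).
Proof.
move=> ch fh; rewrite /crepr; set S := [set h | _].
have Sh : S h by split => //; [exact: ch true|exact: ch false].
by case: (xgetP 0 S) => [? _ [c1 c2 e]|/(_ h)] //; split=> // -[].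
Qed.

Lemma creprE l f h : 0 < l -> cts_on l h -> eq_on l f h ->
  forall x, x \in `[0, l] -> crepr l f x = h x.
Proof.
move=> l0 ch fh; have [c e] := crepr_of ch fh; apply: cts_on_eq => //.
exact: eq_on_trans (eq_on_sym e) fh.
Qed.

(** The continuous representative is the constant plus the primitive of
    [weak_primitive], in each of the two parts. *)
Lemma creprP l f : 0 < l -> inH l 1 f ->
  cts_on l (crepr l f) /\ eq_on l f (crepr l f).
Proof.
move=> l0 [F [g [/weak_part wg [G _]]]].
have i b := weak_has_crepr l0 (inL2_integrable b F) (inL2_integrable b G) (wg b).
have [h1 c1 e1] := i true; have [h2 c2 e2] := i false.
apply: (@crepr_of l f (fun x => h1 x +i* h2 x)); first by case.
by apply: part_eq_on => -[].
Qed.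

(** In H^2 the weak derivative has itself a continuous representative, and the
    function is its classical primitive. *)
Lemma crepr_deriv l f b x : 0 < l -> inH l 2 f -> x \in `]0, l[ ->
  is_derive x 1 (fun x => part b (crepr l f x)) (part b (crepr l (wderiv l f) x)).
Proof.
move=> l0 Hf xD.
have [/weak_part w1 h1] := inH_wderiv l0 Hf.
have [c e] := creprP l0 (inH_leq (leqnSn 1) Hf).
have [c' e'] := creprP l0 h1.
have F := inH_L2 Hf; have G := inH_L2 h1.
exact: (weak_classical l0 (inL2_integrable b F) (inL2_integrable b G) (w1 b)
  (c b) (eq_on_part b e) (c' b) (eq_on_part b e') xD).
Qed.

Lemma cts_on_lin l (a : R[i]) h k : cts_on l h -> cts_on l k -> cts_on l (a *: h + k).
Proof.
move=> ch ck b.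
rewrite (_ : (fun x => _) = (fun x => (if b
    then part true a * part true (h x) - part false a * part false (h x)
    else part true a * part false (h x) + part false a * part true (h x))
    + part b (k x))); last first.
  by apply/funext => x; rewrite -partM -partD.
move=> x; apply: cvgD; last exact: ck.
case: b; [apply: cvgB|apply: cvgD]; apply: cvgM; try exact: cvg_cst; exact: ch.
Qed.

Lemma trace_lin l (a : R[i]) f g x : 0 < l -> inH l 1 f -> inH l 1 g ->
  x \in `[0, l] -> trace l (a *: f + g) x = a * trace l f x + trace l g x.
Proof.
move=> l0 Hf Hg xD; rewrite /trace.
have [c1 e1] := creprP l0 Hf; have [c2 e2] := creprP l0 Hg.
rewrite (creprE l0 (cts_on_lin (a := a) c1 c2) _ xD)//.
by apply: eq_onD => //; exact: eq_onZ.
Qed.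

Lemma trace_eq_on l f g x : 0 < l -> inH l 1 f -> inH l 1 g -> eq_on l f g ->
  x \in `[0, l] -> trace l f x = trace l g x.
Proof.
move=> l0 Hf Hg fg xD; have [c2 e2] := creprP l0 Hg.
apply: (creprE l0 c2) => //; exact: eq_on_trans fg e2.
Qed.

Lemma trace0 l x : 0 < l -> x \in `[0, l] -> trace l (0 : cfun R) x = 0.
Proof.
move=> l0 xD; apply: (@creprE l 0 0) => //; last exact: eq_on_refl.
move=> b; rewrite (_ : (fun x => _) = cst (0 : R)).
  by move=> ?; exact: cvg_cst.
by apply/funext => ?; exact: part0.
Qed.

End Sobolev.

(** * Oscillating and hyperbolic equations *)

Section ODE.
Context {R : realType}.
Implicit Types (l x z om : R) (h : R -> R).

Lemma constant_itv l h : 0 < l -> {within `[0, l], continuous h} ->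
  (forall x, x \in `]0, l[ -> is_derive x 1 h 0) ->
  forall x, x \in `[0, l] -> h x = h 0.
Proof.
move=> l0 ch dh x; rewrite in_itv/= => /andP[x0 xl].
have ch' : {within `[0, x], continuous h}.
  by apply: continuous_subspaceW ch; apply: subset_itvl; rewrite bnd_simp.
have dh' : forall y, y \in `]0, x[ -> is_derive y 1 h 0.
  move=> y; rewrite in_itv/= => /andP[y0 yx]; apply: dh.
  by rewrite in_itv/= y0 (lt_le_trans yx xl).
have [c _] := MVT_segment x0 dh' ch'.
by rewrite mul0r => /eqP; rewrite subr_eq0 => /eqP.
Qed.

Lemma is_derive_cos_lin om x : is_derive x 1 (fun y => cos (om * y)) (- om * sin (om * x)).
Proof.
have D : is_derive x 1 (fun y => om * y) om.
  by apply: is_derive_eq; rewrite /GRing.scale/= mulr1.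
have := is_derive1_comp (is_derive_cos (om * x)) D.
by move=> /is_derive_eq; apply; ring.
Qed.

Lemma is_derive_sin_lin om x : is_derive x 1 (fun y => sin (om * y)) (om * cos (om * x)).
Proof.
have D : is_derive x 1 (fun y => om * y) om.
  by apply: is_derive_eq; rewrite /GRing.scale/= mulr1.
have := is_derive1_comp (is_derive_sin (om * x)) D.
by move=> /is_derive_eq; apply; ring.
Qed.

Lemma is_derive_exp_lin om x : is_derive x 1 (fun y => expR (om * y)) (om * expR (om * x)).
Proof.
have D : is_derive x 1 (fun y => om * y) om.
  by apply: is_derive_eq; rewrite /GRing.scale/= mulr1.
have := is_derive1_comp (is_derive_expR (om * x)) D.
by move=> /is_derive_eq; apply; ring.
Qed.

Lemma continuous_cos_lin om : continuous (fun y => cos (om * y)).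
Proof. by apply: is_derive_continuous => x; exact: is_derive_cos_lin. Qed.

Lemma continuous_sin_lin om : continuous (fun y => sin (om * y)).
Proof. by apply: is_derive_continuous => x; exact: is_derive_sin_lin. Qed.

Lemma continuous_exp_lin om : continuous (fun y => expR (om * y)).
Proof. by apply: is_derive_continuous => x; exact: is_derive_exp_lin. Qed.

Lemma within_lin2 l (h1 h2 g1 g2 : R -> R) :
  {within `[0, l], continuous h1} -> {within `[0, l], continuous h2} ->
  continuous g1 -> continuous g2 ->
  {within `[0, l], continuous (fun x => h1 x * g1 x + h2 x * g2 x)}.
Proof.
move=> c1 c2 k1 k2 x; apply: cvgD; apply: cvgM; try exact: c1; try exact: c2;
  exact: continuous_subspaceT.
Qed.

(** The two combinations h cos - (h' / om) sin and h sin + (h' / om) cos are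
    constant; solving this rotation for h and h' gives the claim. *)
Lemma oscillator l om h h1 : 0 < l -> om != 0 ->
  {within `[0, l], continuous h} -> {within `[0, l], continuous h1} ->
  (forall x, x \in `]0, l[ -> is_derive x 1 h (h1 x)) ->
  (forall x, x \in `]0, l[ -> is_derive x 1 h1 (- om ^+ 2 * h x)) ->
  forall x, x \in `[0, l] ->
    h x = h 0 * cos (om * x) + h1 0 / om * sin (om * x) /\
    h1 x / om = h1 0 / om * cos (om * x) - h 0 * sin (om * x).
Proof.
move=> l0 om0 ch ch1 dh dh1 x xD.
pose c y := cos (om * y); pose s y := sin (om * y).
have kc : continuous c by exact: continuous_cos_lin.
have ks : continuous s by exact: continuous_sin_lin.
have kcZ : continuous (fun y => om^-1 * c y).
  by move=> y; apply: cvgM; [exact: cvg_cst|exact: kc].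
have ksZ : continuous (fun y => - om^-1 * s y).
  by move=> y; apply: cvgM; [exact: cvg_cst|exact: ks].
have D1 : forall y, y \in `]0, l[ ->
    is_derive y 1 (fun y => h y * c y + h1 y * (- om^-1 * s y)) 0.
  move=> y yD; have d0 := dh y yD; have d1 := dh1 y yD.
  have d2 := is_derive_cos_lin om y; have d3 := is_derive_sin_lin om y.
  apply: is_derive_eq; rewrite /GRing.scale/= /c /s; field.
  exact: om0.
have D2 : forall y, y \in `]0, l[ ->
    is_derive y 1 (fun y => h y * s y + h1 y * (om^-1 * c y)) 0.
  move=> y yD; have d0 := dh y yD; have d1 := dh1 y yD.
  have d2 := is_derive_cos_lin om y; have d3 := is_derive_sin_lin om y.
  apply: is_derive_eq; rewrite /GRing.scale/= /c /s; field.
  exact: om0.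
have := constant_itv l0 (within_lin2 ch ch1 kc ksZ) D1 xD.
have := constant_itv l0 (within_lin2 ch ch1 ks kcZ) D2 xD.
rewrite /c /s !mulr0 cos0 sin0 !mulr0 !mulr1 !addr0 !add0r => E2 E1.
have cs := cos2Dsin2 (om * x).
rewrite -E1 -E2; set C := cos _ in cs *; set S := sin _ in cs *; split.
  transitivity (h x * (C ^+ 2 + S ^+ 2)); first by rewrite cs mulr1.
  by field.
transitivity (h1 x / om * (C ^+ 2 + S ^+ 2)); first by rewrite cs mulr1.
by field.
Qed.

(** (h' + om h) exp(- om x) and (h' - om h) exp(om x) are constant. *)
Lemma hyperbolic l om h h1 : 0 < l -> om != 0 ->
  {within `[0, l], continuous h} -> {within `[0, l], continuous h1} ->
  (forall x, x \in `]0, l[ -> is_derive x 1 h (h1 x)) ->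
  (forall x, x \in `]0, l[ -> is_derive x 1 h1 (om ^+ 2 * h x)) ->
  forall x, x \in `[0, l] ->
    h1 x + om * h x = (h1 0 + om * h 0) * expR (om * x) /\
    h1 x - om * h x = (h1 0 - om * h 0) / expR (om * x).
Proof.
move=> l0 om0 ch ch1 dh dh1 x xD.
pose p y := expR (om * y); pose q y := expR ((- om) * y).
have kp : continuous p by exact: continuous_exp_lin.
have kq : continuous q by exact: continuous_exp_lin.
have kpZ : continuous (fun y => - om * p y).
  by move=> y; apply: cvgM; [exact: cvg_cst|exact: kp].
have kqZ : continuous (fun y => om * q y).
  by move=> y; apply: cvgM; [exact: cvg_cst|exact: kq].
have D1 : forall y, y \in `]0, l[ ->
    is_derive y 1 (fun y => h y * (om * q y) + h1 y * q y) 0.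
  move=> y yD; have d0 := dh y yD; have d1 := dh1 y yD.
  have d3 := is_derive_exp_lin (- om) y.
  by apply: is_derive_eq; rewrite /GRing.scale/= /q; ring.
have D2 : forall y, y \in `]0, l[ ->
    is_derive y 1 (fun y => h y * (- om * p y) + h1 y * p y) 0.
  move=> y yD; have d0 := dh y yD; have d1 := dh1 y yD.
  have d3 := is_derive_exp_lin om y.
  by apply: is_derive_eq; rewrite /GRing.scale/= /p; ring.
have := constant_itv l0 (within_lin2 ch ch1 kqZ kq) D1 xD.
have := constant_itv l0 (within_lin2 ch ch1 kpZ kp) D2 xD.
have -> : q x = (expR (om * x))^-1 by rewrite /q mulNr expRN.
rewrite /p /q !mulr0 expR0 !mulr1 => E2 E1.
have e0 : expR (om * x) != 0 by rewrite gt_eqF// expR_gt0.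
split.
  rewrite (_ : h1 0 + om * h 0 = h 0 * om + h1 0); last by ring.
  by rewrite -E1; field.
rewrite (_ : h1 0 - om * h 0 = h 0 * - om + h1 0); last by ring.
by rewrite -E2; field.
Qed.

(** Up to the factor exp x this says that 2 sinh x - 2 sin x is positive, which
    holds because its derivative 2 cosh - 2 cos is positive on the half-line. *)
Lemma sin_lt_sinh x : 0 < x -> 0 < expR x ^+ 2 - 2 * expR x * sin x - 1.
Proof.
move=> x0.
pose f (y : R) := expR (1 * y) - expR ((- 1) * y) - 2 * sin (1 * y).
have D (y : R) : is_derive y 1 f (expR y + expR (- y) - 2 * cos y).
  have d1 := is_derive_exp_lin 1 y; have d2 := is_derive_exp_lin (- 1) y.
  have d3 := is_derive_sin_lin 1 y.
  by apply: is_derive_eq; rewrite /GRing.scale/= !mul1r !mulN1r; ring.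
have cf : {within `[0, x], continuous f}.
  by apply: continuous_subspaceT; exact: is_derive_continuous D.
have [c] := MVT x0 (fun y _ => D y) cf.
rewrite in_itv/= => /andP[c0 cx].
rewrite /f !mulr0 expR0 sin0 mulr0 !subr0 subrr subr0 !mul1r mulN1r => E.
have ec : 1 < expR c by rewrite expR_gt1.
have pos : 0 < expR c + expR (- c) - 2 * cos c.
  have := cos_le1 c.
  suff : 2 < expR c + expR (- c) by lra.
  rewrite expRN -subr_gt0.
  have -> : expR c + (expR c)^-1 - 2 = (expR c - 1) ^+ 2 / expR c.
    by field; rewrite gt_eqF// expR_gt0.
  by rewrite divr_gt0 ?expR_gt0// exprn_gt0// subr_gt0.
have e0 := expR_gt0 x.
have -> : expR x ^+ 2 - 2 * expR x * sin x - 1 =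
    expR x * (expR x - (expR x)^-1 - 2 * sin x).
  by field; rewrite gt_eqF.
by rewrite -expRN E; apply: mulr_gt0 => //; apply: mulr_gt0.
Qed.

(** The elimination behind the matrix of a beam. Here c, s, e are the cosine, the
    sine and the exponential of z l; a, d, w stand for u, u' / z, u''' / z^3 at
    the left end, and bL, dL, wL for the same quantities at the right end. The
    first two equations come from the oscillation of u'' - z^2 u, the last two
    from the growth of u'' + z^2 u. Comparing the two values of bL determines d,
    since the coefficient D is nonzero; then d is eliminated from bL and wL. *)
Lemma beam_algebra (a w d bL wL dL c s e : R) :
  0 < e -> c ^+ 2 + s ^+ 2 = 1 -> e ^+ 2 - 2 * e * s - 1 != 0 ->
  bL = a * c - (w - d) * s ->
  wL - dL = (w - d) * c + a * s ->
  (wL + dL) + bL = ((w + d) + a) * e ->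
  (wL + dL) - bL = ((w + d) - a) / e ->
  let D := e ^+ 2 - 2 * e * s - 1 in
  [/\ bL = D^-1 * ((e ^+ 2 * (c - s) - c - s) * a + 2 * s * (1 - e ^+ 2) * w),
      wL = D^-1 * ((e ^+ 2 * c - 2 * e + c) * a + (e ^+ 2 * (c - s) - c - s) * w)
    & D * d = - (a * (e ^+ 2 + 1 - 2 * e * c) + w * (e ^+ 2 - 1 + 2 * e * s))].
Proof.
move=> e0 cs Dn0 E1 E2 E3 E4 D; have en0 : e != 0 by rewrite gt_eqF.
have {E4} E4 : (wL + dL - bL) * e = w + d - a by rewrite E4 divfK.
have Ed : D * d = - (a * (e ^+ 2 + 1 - 2 * e * c) + w * (e ^+ 2 - 1 + 2 * e * s)).
  have : ((wL + dL) + bL) * e - (wL + dL - bL) * e = 2 * e * bL by ring.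
  rewrite E3 E4 E1 /D => H; apply/eqP; rewrite -subr_eq0; apply/eqP.
  transitivity ((w + d + a) * e * e - (w + d - a) -
    2 * e * (a * c - (w - d) * s)); last by rewrite H subrr.
  ring.
split=> //; apply: (mulfI Dn0); rewrite mulVKf//.
  rewrite E1 -/D.
  transitivity (D * (a * c - w * s) + s * (D * d)); first by ring.
  by rewrite Ed /D; ring.
have H : wL = 2^-1 * ((w - d) * c + a * s + ((w + d + a) * e - bL)).
  by rewrite -E2 -E3; field.
rewrite -/D H E1.
transitivity (2^-1 * (D * (w * c + a * s + (w + a) * e - a * c + w * s)
   + (e - c - s) * (D * d))); first by ring.
rewrite Ed /D.
(* The two sides differ by a multiple of c^2 + s^2 - 1. *)
transitivity (((e ^+ 2 * c - 2 * e + c) * a + (e ^+ 2 * (c - s) - c - s) * w)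
  + a * e * (1 - (c ^+ 2 + s ^+ 2))); last by rewrite cs subrr mulr0 addr0.
by field.
Qed.

End ODE.

(** * Transfer matrices of one component *)

Section Transfer.
Context {R : realType}.
Implicit Types (l z : R) (f g : cfun R) (b : bool).

Definition vec2 (p q : R) : 'cV[R]_2 := \col_i (if i == 0 then p else q).

Lemma mx22_vec2 (p q r s x y : R) :
  mx22 p q r s *m vec2 x y = vec2 (p * x + q * y) (r * x + s * y).
Proof.
apply/matrixP => i j; rewrite !mxE !big_ord_recl big_ord0 !mxE /= addr0.
by case: ifP.
Qed.

Lemma mx22_mul (p q r s p' q' r' s' : R) : mx22 p q r s * mx22 p' q' r' s' =
  mx22 (p * p' + q * r') (p * q' + q * s') (r * p' + s * r') (r * q' + s * s').
Proof.
apply/matrixP => i j; rewrite !mxE !big_ord_recl big_ord0 !mxE /= addr0.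
by case: ifP; case: ifP.
Qed.

Lemma junction_mxV z : 0 < z -> (junction_mx z)^-1 = mx22 1 0 0 (- z).
Proof.
move=> z0; have zn0 : z != 0 by rewrite gt_eqF.
have E : mx22 1 0 0 (- z) * junction_mx z = 1.
  rewrite /junction_mx mx22_mul; apply/matrixP => i j; rewrite !mxE /=.
  rewrite !(mul0r, mulr0, mul1r, addr0, add0r) mulrNN divff//.
  by case: (i) (j) => -[|[|?]] // ? [[|[|?]]].
have E' : junction_mx z * mx22 1 0 0 (- z) = 1 by apply: mulmx1C.
have U : junction_mx z \is a GRing.unit by apply/unitrP; exists (mx22 1 0 0 (- z)).
by apply: (mulrI U); rewrite mulrV.
Qed.

(** An equation for the weak derivative improves the regularity: this is the
    bootstrap that makes weak solutions of the equations classical. *)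
Lemma inH_succ l k f g : 0 < l -> inH l 1 f -> eq_on l (wderiv l f) g ->
  inH l k g -> inH l k.+1 f.
Proof.
move=> l0 Hf fg Hg; split; first exact: inH_L2 Hf.
have [w [L _]] := inH_wderiv l0 Hf.
have F := inL2_meas (inH_L2 Hf).
exists g; split=> //.
exact: (weak_eq_on F F (inL2_meas L) (inL2_meas (inH_L2 Hg)) (eq_on_refl l f) fg w).
Qed.

(** A weak solution of the equation f^(m+1) = k f gains one derivative from the
    equation, so that all the derivatives up to the order [m], represented by
    their traces, are classically differentiable. *)
Lemma ode_classical l m (k : R) f b : 0 < l -> inH l m.+1 f ->
  eq_on l (wderivn l m.+1 f) (k%:C *: f) ->
  [/\ forall i, (i <= m)%N ->
        {within `[0, l], continuous (fun x => part b (trace l (wderivn l i f) x))},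
      forall i x, (i < m)%N -> x \in `]0, l[ ->
        is_derive x 1 (fun x => part b (trace l (wderivn l i f) x))
                      (part b (trace l (wderivn l i.+1 f) x))
    & forall x, x \in `]0, l[ ->
        is_derive x 1 (fun x => part b (trace l (wderivn l m f) x))
                      (k * part b (trace l f x))].
Proof.
move=> l0 Hf E.
have Hi i : (i <= m)%N -> inH l 1 (wderivn l i f).
  move=> im; apply: inH_wderivn => //; apply: inH_leq Hf.
  by rewrite addn1.
split=> [i im|i x im xD|x xD].
- by have [c _] := creprP l0 (Hi i im); exact: c.
- apply: crepr_deriv => //; apply: inH_wderivn => //; apply: inH_leq Hf.
  by rewrite addn2.
- have H1 := Hi m (leqnn m).
  have Hkf : inH l 1 (k%:C *: f) by apply: inHZ; exact: inH_leq Hf.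
  have E' : eq_on l (wderiv l (wderivn l m f)) (k%:C *: f) by [].
  have H2 := inH_succ l0 H1 E' Hkf.
  have := crepr_deriv b l0 H2 xD.
  have [_ H3] := inH_wderiv l0 H2.
  have xD' : x \in `[0, l] by exact: subset_itv_oo_cc xD.
  move=> /is_derive_eq; apply; rewrite -/(trace _ _ _).
  rewrite (trace_eq_on l0 H3 Hkf E' xD').
  rewrite -[k%:C *: f]addr0 trace_lin//; [|exact: inH_leq Hf|exact: inH0].
  by rewrite trace0// addr0 partMl.
Qed.

(** The normalisations by z^2 for a string and by z^3 for a beam are those for
    which the transfer matrices are [string_mx] and [beam_mx]. *)
Definition string_state l z f b x :=
  vec2 (part b (trace l f x)) (part b (trace l (wderivn l 1 f) x) / z ^+ 2).

Definition beam_state l z f b x :=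
  vec2 (part b (trace l f x)) (part b (trace l (wderivn l 3 f) x) / z ^+ 3).

Lemma vec2_eq0 p q : vec2 p q = 0 -> p = 0 /\ q = 0.
Proof.
by move=> /matrixP E; have := E 0 0; have := E 1 0; rewrite !mxE /= => -> ->.
Qed.

Lemma string_transfer l z f b : 0 < l -> 0 < z -> inH l 2 f ->
  eq_on l (wderivn l 2 f) ((- z ^+ 4)%:C *: f) ->
  string_state l z f b l = string_mx l z *m string_state l z f b 0 /\
  (string_state l z f b 0 = 0 -> forall x, x \in `[0, l] -> part b (trace l f x) = 0).
Proof.
move=> l0 z0 Hf E; have [C D1 D2] := ode_classical b l0 Hf E.
have z20 : z ^+ 2 != 0 by rewrite expf_neq0// gt_eqF.
have ll : l \in `[0, l] by rewrite in_itv/= lexx ltW.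
have D2' x : x \in `]0, l[ -> is_derive x 1
    (fun x => part b (trace l (wderivn l 1 f) x))
    (- (z ^+ 2) ^+ 2 * part b (trace l f x)).
  by move=> /D2; rewrite -exprM.
have := oscillator l0 z20 (C 0%N isT) (C 1%N isT) (fun x => D1 0%N x isT) D2'.
rewrite /wderivn /= => Osc; split.
  have [oa ob] := Osc l ll.
  rewrite /string_state /wderivn /= /string_mx mx22_vec2 oa ob [z ^+ 2 * l]mulrC.
  by congr vec2; ring.
rewrite /string_state => /vec2_eq0 [e1 e2] x xD.
have [-> _] := Osc x xD.
by rewrite e1 [X in X * sin _]e2 !mul0r addr0.
Qed.

Lemma addsub_eq0 (p q : R) : p + q = 0 -> p - q = 0 -> q = 0.
Proof. by move=> h1 h2; lra. Qed.

(** u'' - z^2 u oscillates and u'' + z^2 u is hyperbolic, both with frequency z.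
    As u'' vanishes at both ends, their end values are those of z^2 u up to the
    sign, which is the input of [beam_algebra]. If u and u''' vanish at the left
    end, [beam_algebra] forces u' to vanish there too, hence both combinations
    are zero everywhere. *)
Lemma beam_transfer l z f b : 0 < l -> 0 < z -> inH l 4 f ->
  eq_on l (wderivn l 4 f) ((z ^+ 4)%:C *: f) ->
  trace l (wderivn l 2 f) 0 = 0 -> trace l (wderivn l 2 f) l = 0 ->
  beam_state l z f b l = beam_mx l z *m beam_state l z f b 0 /\
  (beam_state l z f b 0 = 0 -> forall x, x \in `[0, l] -> part b (trace l f x) = 0).
Proof.
move=> l0 z0 Hf E T0 Tl; have [C D1 D2] := ode_classical b l0 Hf E.
have zn0 : z != 0 by rewrite gt_eqF.
have ll : l \in `[0, l] by rewrite in_itv/= lexx ltW.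
have l00 : 0 \in `[0, l] by rewrite in_itv/= lexx ltW.
set h := fun x => part b (trace l f x).
pose h1 x := part b (trace l (wderivn l 1 f) x).
pose h2 x := part b (trace l (wderivn l 2 f) x).
pose h3 x := part b (trace l (wderivn l 3 f) x).
have h20 : h2 0 = 0 by rewrite /h2 T0 part0.
have h2l : h2 l = 0 by rewrite /h2 Tl part0.
have c0 : {within `[0, l], continuous h} := C 0%N isT.
have c1 : {within `[0, l], continuous h1} := C 1%N isT.
have c2 : {within `[0, l], continuous h2} := C 2%N isT.
have c3 : {within `[0, l], continuous h3} := C 3%N isT.
have d0 x : x \in `]0, l[ -> is_derive x 1 h (h1 x) := D1 0%N x isT.
have d1 x : x \in `]0, l[ -> is_derive x 1 h1 (h2 x) := D1 1%N x isT.
have d2 x : x \in `]0, l[ -> is_derive x 1 h2 (h3 x) := D1 2%N x isT.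
have d3 x : x \in `]0, l[ -> is_derive x 1 h3 (z ^+ 4 * h x) := D2 x.
have clin (k : R) (u v : R -> R) : {within `[0, l], continuous u} ->
    {within `[0, l], continuous v} ->
    {within `[0, l], continuous (fun x => u x + k * v x)}.
  move=> cu cv x; apply: cvgD; first exact: cu.
  by apply: cvgM; [exact: cvg_cst|exact: cv].
have dlin (k : R) (u v u' v' : R -> R) (x : R) : is_derive x 1 u (u' x) ->
    is_derive x 1 v (v' x) -> is_derive x 1 (fun x => u x + k * v x) (u' x + k * v' x).
  by move=> du dv; apply: is_derive_eq; rewrite /GRing.scale/=; ring.
have Osc := oscillator l0 zn0 (clin (- z ^+ 2) _ _ c2 c0) (clin (- z ^+ 2) _ _ c3 c1)
   (fun x xD => dlin (- z ^+ 2) _ _ _ _ x (d2 x xD) (d0 x xD)).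
have dosc x : x \in `]0, l[ -> is_derive x 1 (fun x => h3 x + - z ^+ 2 * h1 x)
    (- z ^+ 2 * (h2 x + - z ^+ 2 * h x)).
  move=> xD; have := dlin (- z ^+ 2) _ _ (fun x => z ^+ 4 * h x) _ x (d3 x xD) (d1 x xD).
  by move=> /is_derive_eq; apply; ring.
have dh x : x \in `]0, l[ -> is_derive x 1 (fun x => h3 x + z ^+ 2 * h1 x)
    (z ^+ 2 * (h2 x + z ^+ 2 * h x)).
  move=> xD; have := dlin (z ^+ 2) _ _ (fun x => z ^+ 4 * h x) _ x (d3 x xD) (d1 x xD).
  by move=> /is_derive_eq; apply; ring.
have {}Osc := Osc dosc.
have Hy := hyperbolic l0 zn0 (clin (z ^+ 2) _ _ c2 c0) (clin (z ^+ 2) _ _ c3 c1)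
   (fun x xD => dlin (z ^+ 2) _ _ _ _ x (d2 x xD) (d0 x xD)) dh.
have [oa ob] := Osc l ll.
have [Y1 Y2] := Hy l ll.
rewrite h20 h2l in oa ob Y1 Y2.
set c := cos (z * l) in oa ob; set s := sin (z * l) in oa ob.
set e := expR (z * l) in Y1 Y2.
have e0 : 0 < e by exact: expR_gt0.
have zl : 0 < z * l by rewrite mulr_gt0.
have Dpos := sin_lt_sinh zl; rewrite -/e -/s in Dpos.
have Dn0 : e ^+ 2 - 2 * e * s - 1 != 0 by rewrite gt_eqF.
have en0 : e != 0 by rewrite gt_eqF.
have cs : c ^+ 2 + s ^+ 2 = 1 by exact: cos2Dsin2.
have [] := @beam_algebra R (h 0) (h3 0 / z ^+ 3) (h1 0 / z) (h l)
    (h3 l / z ^+ 3) (h1 l / z) c s e e0 cs Dn0.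
- apply: (mulfI (_ : - z ^+ 2 != 0)); first by rewrite oppr_eq0 expf_neq0.
  rewrite add0r in oa; rewrite oa; by field.
- apply: (mulfI (_ : z ^+ 2 != 0)); first by rewrite expf_neq0.
  transitivity ((h3 l + - z ^+ 2 * h1 l) / z); first by field.
  rewrite ob; by field.
- apply: (mulfI (_ : z ^+ 3 != 0)); first by rewrite expf_neq0.
  transitivity (h3 l + z ^+ 2 * h1 l + z * (0 + z ^+ 2 * h l)); first by field.
  rewrite Y1; by field.
- apply: (mulfI (_ : z ^+ 3 != 0)); first by rewrite expf_neq0.
  transitivity (h3 l + z ^+ 2 * h1 l - z * (0 + z ^+ 2 * h l)); first by field.
  rewrite Y2; by field; rewrite en0 zn0.
move=> B1 B2 B3; split.
  rewrite /beam_state -/(h l) -/(h3 l) -/(h 0) -/(h3 0) B1 B2 /beam_mx.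
  have -> : expR (2 * l * z) = e ^+ 2.
    by rewrite /e -expRM_natl; congr expR; ring.
  rewrite [l * z]mulrC -/c -/s -/e -scalemxAl mx22_vec2.
  by apply/matrixP => i j; rewrite !mxE; case: ifP.
rewrite /beam_state => /vec2_eq0 [z1 z2] x xD.
have h00 : h 0 = 0 by [].
have w0 : h3 0 / z ^+ 3 = 0 by [].
have h30 : h3 0 = 0 by rewrite -[h3 0](divfK (_ : z ^+ 3 != 0)) ?w0 ?mul0r// expf_neq0.
have h10 : h1 0 = 0.
  have {}B3 : (e ^+ 2 - 2 * e * s - 1) * (h1 0 / z) = 0 by rewrite B3 h00 w0; ring.
  move/eqP: B3; rewrite mulf_eq0 (negbTE Dn0)/= mulf_eq0 invr_eq0 (negbTE zn0) orbF.
  by move/eqP.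
have [V1 V2] := Hy x xD; have [W1 W2] := Osc x xD.
have {W2} W1' : h2 x + - z ^+ 2 * h x = 0 by rewrite W1 h00 h10 h20 h30; ring.
have V1' : h3 x + z ^+ 2 * h1 x + z * (h2 x + z ^+ 2 * h x) = 0.
  by rewrite V1 h00 h10 h20 h30; ring.
have V2' : h3 x + z ^+ 2 * h1 x - z * (h2 x + z ^+ 2 * h x) = 0.
  by rewrite V2 h00 h10 h20 h30; ring.
have ez : h2 x + z ^+ 2 * h x = 0.
  have := addsub_eq0 V1' V2'.
  by move/eqP; rewrite mulf_eq0 (negbTE zn0) => /eqP.
rewrite mulNr in W1'; have := addsub_eq0 ez W1'.
by move/eqP; rewrite mulf_eq0 expf_eq0 (negbTE zn0) => /eqP.
Qed.

End Transfer.

(** * Explicit solutions *)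

Section Smooth.
Context {R : realType}.
Notation mu := (@lebesgue_measure R).
Implicit Types (l z : R) (c : R[i]).

(** The derivatives are part of the data because the iterated weak derivatives
    are compared with each of them. *)
Definition smooth (F : nat -> R -> R) :=
  forall k (x : R), is_derive x 1 (F k) (F k.+1 x).

Definition cscale c (f : R -> R) : cfun R := fun x => c * (f x)%:C.

Lemma smooth_continuous F k : smooth F -> continuous (F k).
Proof. by move=> sF; exact: is_derive_continuous (sF k). Qed.

Lemma part_cscale b c f x : part b (cscale c f x) = part b c * f x.
Proof. exact: partMr. Qed.

Lemma cts_on_cscale l c f : continuous f -> cts_on l (cscale c f).
Proof.
move=> cf b; rewrite (_ : (fun x => _) = (fun x => part b c * f x)); last first.
  by apply/funext => x; exact: part_cscale.
by apply: continuous_subspaceT => x; apply: cvgM; [exact: cvg_cst|exact: cf].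
Qed.

Lemma inL2_cscale l c f : continuous f -> inL2 l (cscale c f).
Proof.
move=> cf; apply/inL2P; split=> [b|].
  rewrite (_ : (fun x => _) = (fun x => part b c * f x)); last first.
    by apply/funext => x; exact: part_cscale.
  apply: measurable_funM => //; apply: measurable_funTS.
  exact: continuous_measurable_fun.
have cg : continuous (fun x => cmod c ^+ 2 * (f x * f x)).
  move=> x; apply: cvgM; first exact: cvg_cst.
  by apply: cvgM; exact: cf.
have ig : mu.-integrable `[0, l] (EFin \o (fun x => cmod c ^+ 2 * (f x * f x))).
  apply: continuous_compact_integrable; first exact: segment_compact.
  exact: continuous_subspaceT.
have ig' : mu.-integrable `]0, l[ (EFin \o (fun x => cmod c ^+ 2 * (f x * f x))).
  by apply: integrableS ig => //; exact: subset_itv_oo_cc.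
case/integrableP: ig' => _; apply: le_lt_trans.
rewrite le_eqVlt; apply/orP; left; apply/eqP; apply: eq_integral => x _.
rewrite /= cmodM exprMn.
have -> : cmod (f x)%:C ^+ 2 = f x * f x.
  by rewrite cmod_sq /part /= expr0n addr0 expr2.
by rewrite ger0_norm// mulr_ge0 ?sqr_ge0// -expr2 sqr_ge0.
Qed.

(** Integration by parts. *)
Lemma weak_cscale l c F k : 0 < l -> smooth F ->
  is_weak_deriv l (cscale c (F k)) (cscale c (F k.+1)).
Proof.
move=> l0 sF; apply/weak_part => b phi tphi.
have D (x : R) : is_derive x 1 (fun y => part b c * F k y) (part b c * F k.+1 x).
  by have d := sF k x; apply: is_derive_eq; rewrite /GRing.scale/=; ring.
have C : continuous (fun x => part b c * F k.+1 x).
  move=> x; apply: cvgM; first exact: cvg_cst.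
  exact: smooth_continuous.
have := classical_weak l0 D C tphi => H.
transitivity (\int[mu]_(x in `]0, l[) (part b c * F k x * derive1 phi x)).
  by apply: eq_Rintegral => x _; rewrite part_cscale.
rewrite H; congr (- _).
by apply: eq_Rintegral => x _; rewrite part_cscale.
Qed.

Lemma inH_cscale l c F k m : 0 < l -> smooth F -> inH l m (cscale c (F k)).
Proof.
move=> l0 sF; elim: m k => [|m IH] k.
  by split=> //; apply: inL2_cscale; exact: smooth_continuous.
split; first by apply: inL2_cscale; exact: smooth_continuous.
by exists (cscale c (F k.+1)); split; [exact: weak_cscale|exact: IH].
Qed.

Lemma wderivn_cscale l c F k : 0 < l -> smooth F ->
  eq_on l (wderivn l k (cscale c (F 0%N))) (cscale c (F k)).
Proof.
move=> l0 sF; elim: k => [|k IH]; first exact: eq_on_refl.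
have L i : inL2 l (cscale c (F i)) by apply: inL2_cscale; exact: smooth_continuous.
have H : inH l 1 (wderivn l k (cscale c (F 0%N))).
  by apply: inH_wderivn => //; exact: inH_cscale.
rewrite /wderivn iterS -/(wderivn l k _).
apply: eq_on_trans (wderiv_eq_on l0 H (L k) IH) _.
by apply: wderivE => //; exact: weak_cscale.
Qed.

Lemma trace_cscale l c F k x : 0 < l -> smooth F -> x \in `[0, l] ->
  trace l (wderivn l k (cscale c (F 0%N))) x = c * (F k x)%:C.
Proof.
move=> l0 sF xD; apply: (creprE l0 _ (wderivn_cscale c k l0 sF) xD).
by apply: cts_on_cscale; exact: smooth_continuous.
Qed.

Definition bfun (om p q r s : R) (x : R) :=
  p * cos (om * x) + q * sin (om * x) + r * expR (om * x) + s * expR (- om * x).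

(** Differentiation acts linearly on the four coefficients of [bfun]. *)
Definition bfun_deriv (om p q r s : R) (k : nat) : R -> R :=
  iter k (fun G p q r s => G (om * q) (- om * p) (om * r) (- om * s))
    (bfun om) p q r s.

Lemma is_derive_bfun om p q r s (x : R) : is_derive x 1 (bfun om p q r s)
  (bfun om (om * q) (- om * p) (om * r) (- om * s) x).
Proof.
have d1 := is_derive_cos_lin om x; have d2 := is_derive_sin_lin om x.
have d3 := is_derive_exp_lin om x; have d4 := is_derive_exp_lin (- om) x.
by apply: is_derive_eq; rewrite /GRing.scale/= /bfun; ring.
Qed.

Lemma smooth_bfun om p q r s : smooth (bfun_deriv om p q r s).
Proof.
move=> k; elim: k p q r s => [|k IH] p q r s x; first exact: is_derive_bfun.
exact: IH.
Qed.

Lemma string_solution z a w : 0 < z -> exists F : nat -> R -> R,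
  [/\ smooth F, forall x, F 2%N x = - z ^+ 4 * F 0%N x, F 0%N 0 = a
    & F 1%N 0 / z ^+ 2 = w].
Proof.
move=> z0; exists (bfun_deriv (z ^+ 2) a w 0 0); split.
- exact: smooth_bfun.
- by move=> x; rewrite /bfun_deriv /= /bfun; ring.
- by rewrite /bfun_deriv /= /bfun !mulr0 cos0 sin0; ring.
- rewrite /bfun_deriv /= /bfun !mulr0 cos0 sin0; field.
  by rewrite gt_eqF.
Qed.

(** For given u = a and u''' = z^3 w at the left end, u'' vanishes at both ends
    if u' / z is the value [d] found in [beam_algebra]. *)
Lemma beam_solution l z a w : 0 < l -> 0 < z -> exists F : nat -> R -> R,
  [/\ smooth F, forall x, F 4%N x = z ^+ 4 * F 0%N x, F 2%N 0 = 0, F 2%N l = 0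
    & F 0%N 0 = a /\ F 3%N 0 / z ^+ 3 = w].
Proof.
move=> l0 z0; pose c := cos (z * l); pose s := sin (z * l); pose e := expR (z * l).
have e0 : 0 < e by exact: expR_gt0.
have Dpos := sin_lt_sinh (mulr_gt0 z0 l0); rewrite -/e -/s in Dpos.
have Dn0 : e ^+ 2 - 2 * e * s - 1 != 0 by rewrite gt_eqF.
pose d := - (a * (e ^+ 2 + 1 - 2 * e * c) + w * (e ^+ 2 - 1 + 2 * e * s))
  / (e ^+ 2 - 2 * e * s - 1).
exists (bfun_deriv z (a / 2) ((d - w) / 2) ((a + w + d) / 4) ((a - w - d) / 4)); split.
- exact: smooth_bfun.
- by move=> x; rewrite /bfun_deriv /= /bfun; ring.
- by rewrite /bfun_deriv /= /bfun !mulr0 cos0 sin0 expR0; field.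
- rewrite /bfun_deriv /= /bfun; have -> : expR (- z * l) = e^-1 by rewrite mulNr expRN.
  rewrite -/c -/s -/e /d; field.
  by rewrite Dn0 gt_eqF.
- rewrite /bfun_deriv /= /bfun !mulr0 cos0 sin0 expR0; split; first by field.
  by field; rewrite gt_eqF.
Qed.

End Smooth.

(** * Componentwise algebra of states *)

Section State.
Context {R : realType} (N : nat).
Implicit Types (a : R[i]) (U W : state R N) (u w : Defs.family R N) (i : 'I_(2 * N)).

Let fam_scale a u i : (a *: u) i = a *: u i.
Proof. by rewrite {1}/GRing.scale. Qed.
Let fam_add u w i : (u + w) i = u i + w i.
Proof. by rewrite {1}/GRing.add. Qed.
Let fam_opp u i : (- u) i = - u i.
Proof. by rewrite {1}/GRing.opp. Qed.

(** These identities are conversions, but unfolding both sides at once is so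
    expensive that they are worth isolating as rewriting rules. *)
Lemma state_scale1 a U i : (a *: U).1 i = a *: U.1 i.
Proof.
suff -> : (a *: U).1 = a *: U.1 by exact: fam_scale.
by case: U => u w; rewrite /GRing.scale /=.
Qed.
Lemma state_scale2 a U i : (a *: U).2 i = a *: U.2 i.
Proof.
suff -> : (a *: U).2 = a *: U.2 by exact: fam_scale.
by case: U => u w; rewrite /GRing.scale /=.
Qed.
Lemma state_add1 U W i : (U + W).1 i = U.1 i + W.1 i.
Proof.
suff -> : (U + W).1 = U.1 + W.1 by exact: fam_add.
by case: U W => U1 U2 [W1 W2]; rewrite {1}/GRing.add /=.
Qed.
Lemma state_add2 U W i : (U + W).2 i = U.2 i + W.2 i.
Proof.
suff -> : (U + W).2 = U.2 + W.2 by exact: fam_add.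
by case: U W => U1 U2 [W1 W2]; rewrite {1}/GRing.add /=.
Qed.
Lemma state_opp1 U i : (- U).1 i = - U.1 i.
Proof.
suff -> : (- U).1 = - U.1 by exact: fam_opp.
by case: U => U1 U2; rewrite {1}/GRing.opp /=.
Qed.
Lemma state_opp2 U i : (- U).2 i = - U.2 i.
Proof.
suff -> : (- U).2 = - U.2 by exact: fam_opp.
by case: U => U1 U2; rewrite {1}/GRing.opp /=.
Qed.
Lemma cfun_scale a (f : cfun R) x : (a *: f) x = a * f x. Proof. by []. Qed.
Lemma realM (x y : R) : (x * y)%:C = x%:C * y%:C :> R[i].
Proof. by apply: part_inj => b; rewrite partMr; case: b => //=; rewrite mul0r. Qed.
Lemma realD (x y : R) : (x + y)%:C = x%:C + y%:C :> R[i].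
Proof. by apply: part_inj => b; rewrite partD; case: b => //=; rewrite addr0. Qed.
Lemma realN (x : R) : (- x)%:C = - x%:C :> R[i].
Proof. by apply: part_inj => b; rewrite partN; case: b => //=; rewrite oppr0. Qed.
End State.

(** * Propagation along the chain *)

Section Chain.
Context {R : realType} (N : nat) (l : 'I_(2 * N) -> R) (z : R).
Context (hl : forall i, 0 < l i) (hz : 0 < z).
Implicit Types (i j : 'I_(2 * N)) (v : 'cV[R]_2) (b : bool) (f : cfun R).

Definition comp_mx i : 'M[R]_2 :=
  if beam i then beam_mx (l i) z else string_mx (l i) z.

(** The matrix that converts the vector at the right end of the preceding
    component into the vector at the left end of the component [i]. *)
Definition entry_mx i : 'M[R]_2 :=
  if beam i then junction_mx z
  else if i == 0%N :> nat then 1 else (junction_mx z)^-1.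

Lemma factor_mxE i : factor_mx l z i = comp_mx i * entry_mx i.
Proof.
rewrite /factor_mx /comp_mx /entry_mx; case: ifP => // _.
by case: ifP => // _; rewrite mulr1.
Qed.

(** Extended by 1 beyond the last index, so that the propagation can be defined
    by recursion on the natural numbers. *)
Definition factor_nat (k : nat) : 'M[R]_2 :=
  if insub k is Some i then factor_mx l z i else 1.

Lemma factor_natE i : factor_nat i = factor_mx l z i.
Proof.
rewrite /factor_nat; case: insubP => [j _ ji|]; last by rewrite ltn_ord.
by congr factor_mx; exact: val_inj.
Qed.

(** The vector at the right end of the component k - 1 when [v] is the vector at
    the left end of the whole chain. *)
Fixpoint chain v (k : nat) : 'cV[R]_2 :=
  if k is k'.+1 then factor_nat k' *m chain v k' else v.

Lemma chain_char v : chain v (2 * N) = char_mx l z *m v.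
Proof.
have -> : char_mx l z = \prod_(0 <= i < 2 * N) factor_nat (2 * N - i.+1).
  rewrite big_mkord /char_mx; apply: eq_bigr => i _.
  by rewrite -factor_natE.
set n := (2 * N)%N.
suff H k : (k <= n)%N -> chain v k = \prod_(n - k <= i < n) factor_nat (n - i.+1) *m v.
  by rewrite H// subnn.
elim: k => [_|k IH kn]; first by rewrite subn0 big_geq// mul1mx.
rewrite [LHS]/= (IH (ltnW kn)) [in RHS]big_ltn; last first.
  by rewrite ltn_subrL /= (leq_ltn_trans (leq0n k) kn).
have -> : (n - k.+1).+1 = (n - k)%N by rewrite subnSK.
by rewrite subKn ?(ltnW kn)// mulmxA.
Qed.

Lemma chain0 k : chain 0 k = 0.
Proof. by elim: k => //= k ->; rewrite mulmx0. Qed.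

Lemma vec2E v : v = vec2 (v 0 0) (v 1 0).
Proof.
apply/matrixP => p q; rewrite !mxE [q]ord1; case: (p =P 0) => [->//|p0].
congr (v _ _); apply: val_inj => /=.
by case: p p0 => -[|[|?]] //= ? h; case: h; exact: val_inj.
Qed.

Lemma entry_fst i v : (entry_mx i *m v) 0 0 = v 0 0.
Proof.
rewrite [v]vec2E /entry_mx junction_mxV// /junction_mx; case: ifP => _.
  by rewrite mx22_vec2 !mxE /= mul1r mul0r addr0.
case: ifP => _; first by rewrite mul1mx.
by rewrite mx22_vec2 !mxE /= mul1r mul0r addr0.
Qed.

Definition end_state f b i x :=
  if beam i then beam_state (l i) z f b x else string_state (l i) z f b x.

(** The equations satisfied by the first component of an eigenvector, once the
    second one has been eliminated. *)
Definition modal (U : state R N) :=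
  forall i, eq_on (l i) (wderivn (l i) (if beam i then 4 else 2)%N (U.1 i))
    ((if beam i then z ^+ 4 else - z ^+ 4)%:C *: U.1 i).

Lemma end_state_transfer U b i : inY l U -> modal U ->
  end_state (U.1 i) b i (l i) = comp_mx i *m end_state (U.1 i) b i 0 /\
  (end_state (U.1 i) b i 0 = 0 ->
     forall x, x \in `[0, l i] -> part b (trace (l i) (U.1 i) x) = 0).
Proof.
move=> [_ H T _ _] M; rewrite /end_state /comp_mx.
have := M i; have := H i; have := T i; case: ifP => bi.
  by move=> /(_ isT)[T0 T1] Hi Mi; exact: beam_transfer.
by move=> _ Hi Mi; exact: string_transfer.
Qed.

Lemma beam_succ i j : j = i.+1 :> nat -> beam j = ~~ beam i.
Proof. by rewrite /beam => ->. Qed.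

(** By continuity and by the balance of forces at the junctions, the vector at
    the left end of a component is the entry matrix times the preceding vector;
    the transfer matrix of the component then moves to its right end. *)
Lemma end_state_chain U b : (0 < N)%N -> inY l U -> modal U ->
  exists p : R, forall i,
    end_state (U.1 i) b i 0 = entry_mx i *m chain (vec2 0 p) i /\
    end_state (U.1 i) b i (l i) = chain (vec2 0 p) i.+1.
Proof.
move=> N0 YU M.
have N20 : (0 < 2 * N)%N by rewrite muln_gt0.
pose i0 := Ordinal N20.
have [[[_ Vc V0 _] _] _ _ J1 J2] := YU.
have zn0 : z != 0 by rewrite gt_eqF.
(* As u vanishes at the left end of the chain, the only free datum there is
u' / z^2 on the first string. *)
exists (end_state (U.1 i0) b i0 0 1 0).
set v := vec2 _ _.
suff H k (hk : (k < 2 * N)%N) : end_state (U.1 (Ordinal hk)) b (Ordinal hk) 0 =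
    entry_mx (Ordinal hk) *m chain v k.
  move=> [k hk]; split; first exact: H.
  have [-> _] := end_state_transfer b (Ordinal hk) YU M.
  by rewrite H /= (factor_natE (Ordinal hk)) factor_mxE mulmxA.
elim: k hk => [|k IH] hk.
  have -> : Ordinal hk = i0 by exact: val_inj.
  rewrite /entry_mx /= mul1mx /v /end_state /= /string_state V0// part0.
  by congr vec2; rewrite mxE.
pose j := Ordinal hk; pose i := Ordinal (ltnW hk).
have Ei : end_state (U.1 i) b i (l i) = chain v k.+1.
  have [-> _] := end_state_transfer b i YU M.
  by rewrite IH /= (factor_natE i) factor_mxE mulmxA.
rewrite -/j -Ei.
have ji : j = i.+1 :> nat by [].
have tr := Vc i j ji.
rewrite /entry_mx /end_state (beam_succ ji); case: (boolP (beam i)) => bi /=.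
  rewrite junction_mxV// /beam_state mx22_vec2 /string_state tr.
  have := J2 i j bi ji => /(congr1 (part b)); rewrite partD part0 => /eqP.
  rewrite addr_eq0 => /eqP ->.
  by congr vec2; first ring; field.
have bj : beam j by rewrite (beam_succ ji).
rewrite /junction_mx /string_state mx22_vec2 /beam_state tr.
have := J1 j i bj ji => /(congr1 (part b)); rewrite partD part0 => /eqP.
rewrite addr_eq0 => /eqP ->.
by congr vec2; first ring; field.
Qed.

(** The boundary condition on the right reads m_12 p = 0 for the parameter p of
    [end_state_chain], so p = 0 and all the end vectors vanish; then the
    solution vanishes on each component. *)
Lemma modal_char U : (0 < N)%N -> inY l U -> modal U -> char_mx l z 0 1 != 0 ->
  forall i, eq_on (l i) (U.1 i) 0.
Proof.
move=> N0 YU M ch i.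
have N2 : ((2 * N).-1 < 2 * N)%N by rewrite prednK// muln_gt0.
pose im := Ordinal N2.
have Z b x : x \in `[0, l i] -> part b (trace (l i) (U.1 i) x) = 0.
  have [p Hp] := end_state_chain b N0 YU M.
  have p0 : p = 0.
    have [_] := Hp im.
    have -> : im.+1 = (2 * N)%N by rewrite /= prednK// muln_gt0.
    rewrite chain_char => /matrixP/(_ 0 0).
    have [[[_ _ _ Vl] _] _ _ _ _] := YU.
    have tl : trace (l im) (U.1 im) (l im) = 0.
      by apply: Vl; rewrite /= prednK// muln_gt0.
    have -> : end_state (U.1 im) b im (l im) 0 0 = 0.
      by rewrite /end_state; case: ifP => _; rewrite mxE /= tl part0.
    rewrite mxE !big_ord_recl big_ord0 !mxE /= mulr0 add0r addr0 => /esym/eqP.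
    rewrite mulf_eq0.
    have -> : lift ord0 ord0 = 1 :> 'I_2 by exact: val_inj.
    by rewrite (negbTE ch) => /eqP.
  have [Hi _] := Hp i.
  have [_ Tz] := end_state_transfer b i YU M.
  apply: Tz; rewrite Hi p0.
  have -> : vec2 0 0 = 0 :> 'cV[R]_2.
    by apply/matrixP => ? ?; rewrite !mxE; case: ifP.
  by rewrite chain0 mulmx0.
have [[[Hu _ _ _] _] _ _ _ _] := YU.
have H1 : inH (l i) 1 (U.1 i).
  by apply: inH_leq (Hu i); rewrite /orderV; case: ifP.
have [_ e] := creprP (hl i) H1.
apply: ae_mono e => x ex xD; rewrite ex//.
apply: part_inj => b; rewrite part0; apply: Z.
exact: subset_itv_oo_cc xD.
Qed.

Definition iz2 : R[i] := 0 +i* (z ^+ 2).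

(** That this number is real is why the real and imaginary parts of an
    eigenfunction can be propagated separately. *)
Lemma iz2_sq : iz2 * iz2 = (- z ^+ 4)%:C.
Proof. by rewrite /iz2; apply/eqP; rewrite eq_complex /=; apply/andP; split; apply/eqP; ring. Qed.

Lemma eigen_modal U : eqX l (opA l U) (iz2 *: U) ->
  modal U /\ forall i, eq_on (l i) (U.2 i) (iz2 *: U.1 i).
Proof.
move=> E; have E1 i : eq_on (l i) (U.2 i) (iz2 *: U.1 i).
  by have [h _] := E i; rewrite state_scale1 in h; exact: h.
split; last exact: E1.
move=> i; have [_] := E i; rewrite state_scale2 /opA => {}E.
have E2 : eq_on (l i) (iz2 *: U.2 i) ((- z ^+ 4)%:C *: U.1 i).
  by rewrite -iz2_sq -scalerA; exact: eq_onZ.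
have {E2} := eq_on_trans E E2; rewrite /=.
case: ifP => bi // /eq_onN; rewrite opprK -scaleNr.
by rewrite -realN opprK.
Qed.

(** The vectors propagated from (0, 1) prescribe the initial data of an explicit
    solution on each component. Its vector at the right end is given by
    [string_transfer] or [beam_transfer], so that the junction conditions hold
    by construction, and m_12 = 0 is the condition at the last end. The first
    component is nonzero because its derivative at the origin is z^2. *)
Lemma eigen_exists : (0 < N)%N -> char_mx l z 0 1 = 0 ->
  exists U : state R N,
    [/\ inY l U, ~ eqX l U 0 & eqX l (opA l U) (iz2 *: U)].
Proof.
move=> N0 ch0.
have N20 : (0 < 2 * N)%N by rewrite muln_gt0.
have zn0 : z != 0 by rewrite gt_eqF.
pose v := vec2 (0 : R) 1.
pose inp i := entry_mx i *m chain v i.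
pose P i (F : nat -> R -> R) := [/\ smooth F,
   forall x, F (if beam i then 4 else 2)%N x = (if beam i then z ^+ 4 else - z ^+ 4) * F 0%N x,
   beam i -> F 2%N 0 = 0 /\ F 2%N (l i) = 0,
   F 0%N 0 = inp i 0 0 & (if beam i then F 3%N 0 / z ^+ 3 else F 1%N 0 / z ^+ 2) = inp i 1 0].
have exF i : exists F, P i F.
  rewrite /P; case: ifP => bi.
    have [F [s e a b [p q]]] := beam_solution (inp i 0 0) (inp i 1 0) (hl i) hz.
    by exists F; split.
  have [F [s e p q]] := string_solution (inp i 0 0) (inp i 1 0) hz.
  by exists F; split.
have [F HF] := choice exF.
have sF i : smooth (F i) by have [] := HF i.
pose U : state R N := (fun i => cscale 1 (F i 0%N), fun i => cscale iz2 (F i 0%N)).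
have U1 i : U.1 i = cscale 1 (F i 0%N) by [].
have U2 i : U.2 i = cscale iz2 (F i 0%N) by [].
have li i : l i \in `[0, l i] by rewrite in_itv/= lexx ltW.
have l0 i : 0 \in `[0, l i] by rewrite in_itv/= lexx ltW.
have tr i k x : x \in `[0, l i] ->
    trace (l i) (wderivn (l i) k (U.1 i)) x = (F i k x)%:C.
  by move=> xi; rewrite trace_cscale// mul1r.
have tr2 i x : x \in `[0, l i] -> trace (l i) (U.2 i) x = iz2 * (F i 0%N x)%:C.
  by move=> xi; have := @trace_cscale R (l i) iz2 (F i) 0 x (hl i) (sF i) xi.
have tr0 i x : x \in `[0, l i] -> trace (l i) (U.1 i) x = (F i 0%N x)%:C.
  exact: tr i 0%N x.
have M : modal U.
  move=> i; apply: eq_on_trans (wderivn_cscale _ _ (hl i) (sF i)) _.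
  apply: aeW => x _; have [_ e _ _ _] := HF i.
  by rewrite cfun_scale U1 /cscale e !mul1r realM.
have cst i x : x \in `[0, l i] -> end_state (U.1 i) true i x =
    vec2 (F i 0%N x) (if beam i then F i 3%N x / z ^+ 3 else F i 1%N x / z ^+ 2).
  move=> xi; rewrite /end_state /beam_state /string_state tr0// !tr//.
  by case: ifP.
have st0 i : end_state (U.1 i) true i 0 = inp i.
  rewrite cst// [RHS]vec2E; have [_ _ _ -> ->] := HF i.
  by [].
have YT i : beam i -> trace (l i) (wderivn (l i) 2 (U.1 i)) 0 = 0 /\
     trace (l i) (wderivn (l i) 2 (U.1 i)) (l i) = 0.
  by move=> bi; rewrite !tr//; have [_ _ /(_ bi)[-> ->]] := HF i.
have stl i : end_state (U.1 i) true i (l i) = chain v i.+1.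
  rewrite /= factor_natE factor_mxE -mulmxA -/(inp i) -st0 /end_state /comp_mx.
  have H k : inH (l i) k (U.1 i) by exact: inH_cscale.
  have Mi := M i; case: ifP Mi => bi Mi.
    by have [T0 T1] := YT i bi; case: (beam_transfer true (hl i) hz (H _) Mi T0 T1).
  by case: (string_transfer true (hl i) hz (H _) Mi).
have fst0 i : F i 0%N 0 = chain v i 0 0.
  by have [_ _ _ -> _] := HF i; rewrite /inp entry_fst.
have fstl i : F i 0%N (l i) = chain v i.+1 0 0.
  by rewrite -stl cst// mxE.
have Vn i : i.+1 = (2 * N)%N -> F i 0%N (l i) = 0.
  move=> im; rewrite fstl im chain_char mxE !big_ord_recl big_ord0 !mxE /=.
  have -> : lift ord0 ord0 = 1 :> 'I_2 by exact: val_inj.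
  by rewrite ch0; ring.
have V00 i : i = 0%N :> nat -> F i 0%N 0 = 0.
  by move=> i0; rewrite fst0 i0 /= mxE.
exists U; split.
- split.
  + split; split.
    * by move=> i; exact: inH_cscale.
    * by move=> i j ji; rewrite !tr0// fst0 fstl ji.
    * by move=> i i0; rewrite tr0// V00.
    * by move=> i im; rewrite tr0// Vn.
    * by move=> i; exact: inH_cscale.
    * by move=> i j ji; rewrite !tr2// fst0 fstl ji.
    * by move=> i i0; rewrite tr2// V00// mulr0.
    * by move=> i im; rewrite tr2// Vn// mulr0.
  + by move=> i; exact: inH_cscale.
  + exact: YT.
  + move=> i j bi ij; rewrite !tr//.
    have bj : beam j = false.
      by apply/negbTE; move: bi; rewrite (beam_succ ij).
    have := stl j; rewrite cst// bj -ij => e1.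
    have := st0 i; rewrite cst// bi /inp -e1 /entry_mx bi mx22_vec2.
    move=> /matrixP/(_ 1 0); rewrite !mxE /= mul0r add0r => e2.
    rewrite -realD; suff -> : F i 3%N 0 + F j 1%N (l j) = 0 by [].
    have -> : F i 3%N 0 = z ^+ 3 * (F i 3%N 0 / z ^+ 3) by field.
    by rewrite e2; field.
  + move=> i j bi ji; rewrite !tr//.
    have bj : beam j = false by rewrite (beam_succ ji) bi.
    have := stl i; rewrite cst// bi -ji => e1.
    have j0 : (j == 0%N :> nat) = false by rewrite ji.
    have := st0 j; rewrite cst// bj /inp -e1 /entry_mx bj j0 junction_mxV// mx22_vec2.
    move=> /matrixP/(_ 1 0); rewrite !mxE /= mul0r add0r => e2.
    rewrite -realD; suff -> : F i 3%N (l i) + F j 1%N 0 = 0 by [].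
    have -> : F j 1%N 0 = z ^+ 2 * (F j 1%N 0 / z ^+ 2) by field.
    by rewrite e2; field.
- pose i0 := Ordinal N20 => /(_ i0)[E0 _].
  have H1 : inH (l i0) 1 (U.1 i0) by exact: inH_cscale.
  have H2 : inH (l i0) 2 (U.1 i0) by exact: inH_cscale.
  have E1 := wderivn_eq_on (hl i0) H1 (inL20 (l i0)) E0.
  have {}E1 := eq_on_trans E1 (wderivn0 1 (hl i0)).
  have := trace_eq_on (hl i0) (inH_wderivn (m := 1) (hl i0) H2) (inH0 (l i0) 1) E1 (l0 i0).
  rewrite tr// trace0// => /(congr1 (part true)); rewrite /part /=.
  have [_ _ _ _] := HF i0; rewrite /= /inp /entry_mx /= mul1mx mxE /= => h1 h0.
  by move: h1; rewrite h0 mul0r => /eqP; rewrite eq_sym oner_eq0.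
- move=> i; split; rewrite ?state_scale1 ?state_scale2 /opA /=.
    by apply: aeW => x _; rewrite cfun_scale /cscale mul1r.
  change (eq_on (l i) (if beam i then - wderivn (l i) 4 (U.1 i)
    else wderivn (l i) 2 (U.1 i)) (iz2 *: U.2 i)).
  have Mi := M i; have L : eq_on (l i) (iz2 *: U.2 i) ((- z ^+ 4)%:C *: U.1 i).
    apply: aeW => x _; rewrite !cfun_scale -iz2_sq U1 U2 /cscale mul1r.
    by rewrite mulrA.
  have {}L := eq_on_sym L.
  case: ifP Mi => bi Mi; last exact: eq_on_trans Mi L.
  apply: eq_on_trans L; apply: eq_on_trans (eq_onN Mi) _.
  rewrite -scaleNr (_ : - (z ^+ 4)%:C = (- z ^+ 4)%:C); last by rewrite realN.
  exact: eq_on_refl.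
Qed.

End Chain.

(** * The Riesz projection on eigenvectors *)

Section Riesz.
Context {R : realType} (N : nat) (l : 'I_(2 * N) -> R).
Context (hl : forall i, 0 < l i).
Implicit Types (U W : state R N) (i j : 'I_(2 * N)) (a mu : R[i]).

Lemma eqX_refl U : eqX l U U.
Proof. by move=> i; split; exact: eq_on_refl. Qed.
Lemma eqXZ a U W : eqX l U W -> eqX l (a *: U) (a *: W).
Proof.
move=> H i; have [h1 h2] := H i.
by rewrite !state_scale1 !state_scale2; split; exact: eq_onZ.
Qed.
Lemma eqXD U1 U2 W1 W2 : eqX l U1 W1 -> eqX l U2 W2 -> eqX l (U1 + U2) (W1 + W2).
Proof.
move=> H K i; have [h1 h2] := H i; have [k1 k2] := K i.
by rewrite !state_add1 !state_add2; split; exact: eq_onD.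
Qed.
Lemma end_in i : (0 \in `[0, l i]) * (l i \in `[0, l i]).
Proof. by rewrite !in_itv/= !lexx ltW ?hl. Qed.

Lemma orderV_gt0 i : (0 < orderV i)%N.
Proof. by rewrite /orderV; case: ifP. Qed.

Lemma inV_lin a (u w v : Defs.family R N) : (forall i, v i = a *: u i + w i) ->
  inV l u -> inV l w -> inV l v.
Proof.
move=> E [H1 H2 H3 H4] [K1 K2 K3 K4].
have tr i x : x \in `[0, l i] ->
    trace (l i) (v i) x = a * trace (l i) (u i) x + trace (l i) (w i) x.
  move=> xi; rewrite E trace_lin//.
  - exact: inH_leq (orderV_gt0 i) (H1 i).
  - exact: inH_leq (orderV_gt0 i) (K1 i).
split.
- by move=> i; rewrite E; exact: inH_lin.
- by move=> i j ji; rewrite !tr ?end_in// (H2 _ _ ji) (K2 _ _ ji).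
- by move=> i i0; rewrite !tr ?end_in// (H3 _ i0) (K3 _ i0) mulr0 addr0.
- by move=> i im; rewrite !tr ?end_in// (H4 _ im) (K4 _ im) mulr0 addr0.
Qed.

Lemma state_lin1 a U W i : (a *: U + W).1 i = a *: U.1 i + W.1 i.
Proof. by rewrite state_add1 state_scale1. Qed.
Lemma state_lin2 a U W i : (a *: U + W).2 i = a *: U.2 i + W.2 i.
Proof. by rewrite state_add2 state_scale2. Qed.

(** The orders of derivation in [inY] are numerals of a semiring; here they are
    natural number literals, which keeps unification syntactic. *)
Lemma inYP U : inY l U <-> [/\ inV l U.1 /\ inV l U.2,
      forall i, inH (l i) (if beam i then 4 else 2) (U.1 i),
      forall i, beam i -> trace (l i) (wderivn (l i) 2%N (U.1 i)) 0 = 0 /\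
        trace (l i) (wderivn (l i) 2%N (U.1 i)) (l i) = 0,
      forall i j, beam i -> i = j.+1 :> nat ->
        trace (l i) (wderivn (l i) 3%N (U.1 i)) 0 +
        trace (l j) (wderivn (l j) 1%N (U.1 j)) (l j) = 0
    & forall i j, beam i -> j = i.+1 :> nat ->
        trace (l i) (wderivn (l i) 3%N (U.1 i)) (l i) +
        trace (l j) (wderivn (l j) 1%N (U.1 j)) 0 = 0].
Proof. by []. Qed.

Lemma inY_H U i k : inY l U -> (k <= (if beam i then 4 else 2))%N ->
  inH (l i) k (U.1 i).
Proof. by move=> [_ H _ _ _] hk; exact: inH_leq hk (H i). Qed.

Lemma inY_lin a U W : inY l U -> inY l W -> inY l (a *: U + W).
Proof.
move=> YU YW.
have tr i k x : x \in `[0, l i] -> (k < (if beam i then 4 else 2))%N ->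
    trace (l i) (wderivn (l i) k ((a *: U + W).1 i)) x =
    a * trace (l i) (wderivn (l i) k (U.1 i)) x + trace (l i) (wderivn (l i) k (W.1 i)) x.
  move=> xi hk; rewrite state_lin1.
  have HU : inH (l i) (k + 1) (U.1 i) by apply: inY_H => //; rewrite addn1.
  have HW : inH (l i) (k + 1) (W.1 i) by apply: inY_H => //; rewrite addn1.
  rewrite -trace_lin//; [|exact: inH_wderivn|exact: inH_wderivn].
  apply: trace_eq_on => //.
  - by apply: inH_wderivn => //; exact: inH_lin.
  - by apply: inH_lin; exact: inH_wderivn.
  - by apply: wderivn_lin => //; apply: inY_H => //; exact: ltnW.
have [[VU1 VU2] HU TU JU1 JU2] := (inYP U).1 YU.
have [[VW1 VW2] HW TW JW1 JW2] := (inYP W).1 YW.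
have lin1 (x p q : R[i]) : x = a * p + q -> p = 0 -> q = 0 -> x = 0.
  by move=> -> -> ->; rewrite mulr0 addr0.
have lin2 (x y p q r s : R[i]) : x = a * p + q -> y = a * r + s ->
    p + r = 0 -> q + s = 0 -> x + y = 0.
  by move=> -> -> pr qs; rewrite addrACA -mulrDr pr qs mulr0 addr0.
have in0 i := (end_in i).1; have in1 i := (end_in i).2.
have bb i k : beam i -> (k < 4)%N -> (k < if beam i then 4 else 2)%N by move=> ->.
have bs i : beam i = false -> (1 < if beam i then 4 else 2)%N by move=> ->.
apply/inYP; split.
- split.
    by apply: (inV_lin (a := a) _ VU1 VW1) => i; rewrite state_lin1.
  by apply: (inV_lin (a := a) _ VU2 VW2) => i; rewrite state_lin2.
- by move=> i; rewrite state_lin1; exact: inH_lin.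
- move=> i bi; have [t1 t2] := TU i bi; have [t3 t4] := TW i bi; split.
    exact: (lin1 _ _ _ (tr i 2%N 0 (in0 i) (bb i 2%N bi isT)) t1 t3).
  exact: (lin1 _ _ _ (tr i 2%N (l i) (in1 i) (bb i 2%N bi isT)) t2 t4).
- move=> i j bi ij; have bj : beam j = false.
    by apply/negbTE; move: bi; rewrite (beam_succ ij).
  exact: (lin2 _ _ _ _ _ _ (tr i 3%N 0 (in0 i) (bb i 3%N bi isT))
    (tr j 1%N (l j) (in1 j) (bs j bj)) (JU1 i j bi ij) (JW1 i j bi ij)).
- move=> i j bi ji; have bj : beam j = false by rewrite (beam_succ ji) bi.
  exact: (lin2 _ _ _ _ _ _ (tr i 3%N (l i) (in1 i) (bb i 3%N bi isT))
    (tr j 1%N 0 (in0 j) (bs j bj)) (JU2 i j bi ji) (JW2 i j bi ji)).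
Qed.

Lemma opA_lin a U W : inY l U -> inY l W ->
  eqX l (opA l (a *: U + W)) (a *: opA l U + opA l W).
Proof.
move=> YU YW i; rewrite state_lin1 state_lin2; split.
  change (eq_on (l i) ((a *: U + W).2 i) (a *: U.2 i + W.2 i)).
  by rewrite state_lin2; exact: eq_on_refl.
change (eq_on (l i) (if beam i then - wderivn (l i) 4 ((a *: U + W).1 i)
    else wderivn (l i) 2 ((a *: U + W).1 i))
  (a *: (if beam i then - wderivn (l i) 4 (U.1 i) else wderivn (l i) 2 (U.1 i)) +
   (if beam i then - wderivn (l i) 4 (W.1 i) else wderivn (l i) 2 (W.1 i)))).
rewrite state_lin1.
have [_ HU _ _ _] := YU; have [_ HW _ _ _] := YW.
have := HW i; have := HU i; case: ifP => _ hU hW; last exact: wderivn_lin.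
rewrite scalerN -opprD; apply: eq_onN; exact: wderivn_lin.
Qed.

Lemma inL2_wderivn (r : R) k (f : cfun R) : 0 < r -> inH r k f ->
  inL2 r (wderivn r k f).
Proof. by move=> r0 Hf; apply: (@inH_L2 _ _ 0); apply: inH_wderivn; rewrite ?addn0. Qed.

Lemma inL2_opA U i : inY l U -> inL2 (l i) ((opA l U).2 i).
Proof.
move=> [_ H _ _ _].
change (inL2 (l i) (if beam i then - wderivn (l i) 4 (U.1 i)
  else wderivn (l i) 2 (U.1 i))).
have := H i; case: ifP => _ h; last exact: inL2_wderivn.
by apply: inL2N; exact: inL2_wderivn.
Qed.

Lemma inY_X U : inY l U -> inX l U.
Proof.
move=> [[V1 V2] _ _ _ _]; split=> // i.
by have [H _ _ _] := V2; exact: inH_L2 (H i).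
Qed.

Definition normX_sum U : \bar R :=
  (\sum_i (Hsqnorm (l i) (orderV i) (U.1 i) + L2norm (l i) (U.2 i) ^+ 2))%E.

Lemma Hsqnorm_ge0 (r : R) k f : (0 <= Hsqnorm r k f)%E.
Proof. by apply: sume_ge0 => j _; exact: sqre_ge0. Qed.

Lemma normX_sum_ge0 U : (0 <= normX_sum U)%E.
Proof. by apply: sume_ge0 => i _; rewrite adde_ge0 ?Hsqnorm_ge0 ?sqre_ge0. Qed.

Lemma normX_sq U : (normX l U ^+ 2 = normX_sum U)%E.
Proof. by rewrite /normX -/(normX_sum U) poweR12_sqrt ?normX_sum_ge0// sqr_sqrte ?normX_sum_ge0. Qed.

Lemma normX_ge0 U : (0 <= normX l U)%E.
Proof. exact: poweR_ge0. Qed.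

Lemma sqnorm_le_normX U i :
  (sqnorm (l i) (U.1 i) <= normX l U ^+ 2)%E /\
  (sqnorm (l i) (U.2 i) <= normX l U ^+ 2)%E.
Proof.
rewrite normX_sq /normX_sum (bigD1 i)//=.
set T := (\sum_(j < _ | _) _)%E.
have T0 : (0 <= T)%E.
  by apply: sume_ge0 => j _; rewrite adde_ge0 ?Hsqnorm_ge0 ?sqre_ge0.
rewrite -!L2norm_sq; split; apply: le_trans (leeDl _ T0).
  apply: (@le_trans _ _ (Hsqnorm (l i) (orderV i) (U.1 i))); last first.
    by rewrite leeDl// sqre_ge0.
  rewrite /Hsqnorm big_ord_recl leeDl//.
  by apply: sume_ge0 => j _; exact: sqre_ge0.
by rewrite leeDr// Hsqnorm_ge0.
Qed.

Lemma sqnorm0 (r : R) : sqnorm r (0 : cfun R) = 0%E.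
Proof.
rewrite /sqnorm (eq_integral (fun=> 0%E)) ?integral0// => x _.
by rewrite cmod0 expr0n.
Qed.

Lemma sqnorm_eq_on0 (r : R) f : inL2 r f -> eq_on r f 0 -> sqnorm r f = 0%E.
Proof.
move=> F f0; rewrite (eq_sqnorm (inL2_meas F) (inL2_meas (inL20 r)) f0).
exact: sqnorm0.
Qed.

Lemma normX_eq0 U : (forall i, inH (l i) (orderV i) (U.1 i)) ->
  (forall i, inL2 (l i) (U.2 i)) -> eqX l U 0 -> normX l U = 0%E.
Proof.
move=> H1 H2 U0; suff S0 : normX_sum U = 0%E.
  by rewrite /normX -/(normX_sum U) S0 poweR0r.
rewrite /normX_sum big1// => i _; have [e1 e2] := U0 i.
rewrite L2norm_sq (sqnorm_eq_on0 (H2 i) e2) adde0 /Hsqnorm big1// => -[k hk] _ /=.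
have Hk : inH (l i) k (U.1 i) by apply: inH_leq (H1 i); rewrite -ltnS.
rewrite -expe2 L2norm_sq sqnorm_eq_on0//.
  exact: inL2_wderivn.
apply: eq_on_trans (wderivn0 k (hl i)).
by apply: wderivn_eq_on => //; exact: inL20.
Qed.

(** The estimate in [resolvent_set] bounds the norm of W by the norm of
    (mu - A) W, which is zero. *)
Lemma resolvent_inj mu W : resolvent_set l mu -> inY l W ->
  eqX l (mu *: W - opA l W) 0 -> eqX l W 0.
Proof.
move=> [_ [C HC]] YW E0.
have [[[VW _ _ _] [VW2 _ _ _]] _ _ _ _] := YW.
have nE : normX l (mu *: W - opA l W) = 0%E.
  apply: normX_eq0 => // i.
  - rewrite state_lin1 state_opp1.
    change (inH (l i) (orderV i) (mu *: W.1 i + - W.2 i)).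
    by rewrite -scaleN1r; apply: inH_lin => //; exact: inHZ.
  - rewrite state_lin2 state_opp2; apply: inL2_lin; first exact: inH_L2 (VW2 i).
    by apply: inL2N; exact: inL2_opA.
have n0 : normX l W = 0%E.
  apply/eqP; rewrite eq_le normX_ge0 andbT.
  by apply: le_trans (HC W YW) _; rewrite nE mule0.
move=> i; have [h1 h2] := sqnorm_le_normX W i.
rewrite n0 expe2 mul0e in h1 h2.
split; apply: sqnorm_eq0.
- exact: inL2_meas (inH_L2 (VW i)).
- by apply/eqP; rewrite eq_le h1 sqnorm_ge0.
- exact: inL2_meas (inH_L2 (VW2 i)).
- by apply/eqP; rewrite eq_le h2 sqnorm_ge0.
Qed.

Lemma eqX_sum n (G : 'I_n -> state R N) (c : 'I_n -> R[i]) U :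
  (forall k, eqX l (G k) (c k *: U)) -> eqX l (\sum_k G k) ((\sum_k c k) *: U).
Proof.
move=> H; rewrite scaler_suml.
elim/big_ind2: _ => [|U1 W1 U2 W2 h1 h2|k _]; [exact: eqX_refl| |exact: H].
exact: eqXD.
Qed.

Lemma inL2_sum n (G : 'I_n -> state R N) i :
  (forall k, inL2 (l i) ((G k).1 i) /\ inL2 (l i) ((G k).2 i)) ->
  inL2 (l i) ((\sum_k G k).1 i) /\ inL2 (l i) ((\sum_k G k).2 i).
Proof.
move=> H; elim/big_ind: _ => [|U W [u1 u2] [w1 w2]|k _]; last exact: H.
- by split; exact: inL20.
- by rewrite state_add1 state_add2; split; exact: inL2D.
Qed.

(** Any partitions whose mesh tends to 0 would do; with equal steps the mesh is
    explicit. The tags are taken at the left ends below. *)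
Definition uniform n : seq R := mkseq (fun k => k.+1%:R / n%:R) n.

Lemma nth_uniform n k : (k < n)%N -> nth 1 (uniform n) k = k.+1%:R / n%:R.
Proof. exact: nth_mkseq. Qed.

Lemma nth_uniform0 n k : (k < n)%N -> nth 1 (0 :: uniform n) k = k%:R / n%:R.
Proof.
by case: k => [|k] kn /=; [rewrite mul0r|rewrite nth_uniform// ltnW].
Qed.

Lemma tagged_uniform n (delta : R) : (0 < n)%N -> n%:R^-1 < delta ->
  Defs.tagged delta (uniform n) (fun k => nth 1 (0 :: uniform n) k).
Proof.
move=> n0 nd; have n0' : 0 < n%:R :> R by rewrite ltr0n.
have szn : size (uniform n) = n by rewrite size_mkseq.
split.
  split.
    apply/(pathP 1) => k; rewrite szn => kn.
    by rewrite nth_uniform0// nth_uniform// ltr_pM2r ?invr_gt0// ltr_nat.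
  have pn : (n.-1 < n)%N by rewrite prednK.
  rewrite -nth_last szn (set_nth_default 1) ?szn// nth_uniform// prednK//.
  by rewrite divff// gt_eqF.
move=> k; rewrite szn => kn; rewrite nth_uniform0// nth_uniform//; split=> //.
  by rewrite ler_wpM2r ?invr_ge0 ?ler0n// ler_nat.
by rewrite -mulrBl -natrB// subSnn mul1r.
Qed.

(** The resolvent is injective modulo almost everywhere equality, and
    (mu - lambda)^-1 U solves the equation that defines it. *)
Lemma resolvent_eigen mu lambda U : resolvent_set l mu -> inY l U ->
  eqX l (opA l U) (lambda *: U) -> mu != lambda ->
  inY l (resolvent l mu U) /\ eqX l (resolvent l mu U) ((mu - lambda)^-1 *: U).
Proof.
move=> Rmu YU EU ml; have XU := inY_X YU.
have [Yy Ey] : inY l (resolvent l mu U) /\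
    eqX l (mu *: resolvent l mu U - opA l (resolvent l mu U)) U.
  have [y Hy] := Rmu.1 U XU; rewrite /resolvent.
  by case: xgetP => [? _ //|/(_ y)]; case.
set y := resolvent l mu U in Yy Ey *; split; first exact: Yy.
have d0 : mu - lambda != 0 by rewrite subr_eq0.
pose k := (mu - lambda)^-1.
have YW := inY_lin (- k) YU Yy.
have E0 : eqX l (mu *: (- k *: U + y) - opA l (- k *: U + y)) 0.
  have EL := opA_lin (- k) YU Yy.
  have pt (u a1 a2 w1 w2 : R[i]) : a2 = - k * w1 + w2 -> w1 = lambda * u ->
      mu * a1 - w2 = u -> mu * (- k * u + a1) - a2 = 0.
    move=> -> -> h.
    transitivity ((mu * a1 - w2) - k * (mu - lambda) * u); first by ring.
    by rewrite h /k mulVf// mul1r subrr.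
  (* Both components of (mu - A)(y - k U) are handled by the same pointwise
  identity, where k = (mu - lambda)^-1. *)
  have cmp (u a1 a2 w1 w2 : cfun R) (r : R) : eq_on r a2 (- k *: w1 + w2) ->
      eq_on r w1 (lambda *: u) -> eq_on r (mu *: a1 - w2) u ->
      eq_on r (mu *: (- k *: u + a1) - a2) 0.
    move=> H1 H2 H3.
    have H4 := eq_onD H3 (eq_onZ (- k) (eq_on_sym H2)).
    apply: ae_mono2 H1 (ae_mono2 (fun x p q => conj p q) H2 H3).
    move=> x h1 [h2 h3] xD.
    exact: (pt (u x) (a1 x) (a2 x) (w1 x) (w2 x) (h1 xD) (h2 xD) (h3 xD)).
  move=> i; have [l1 l2] := EL i; have [e1 e2] := EU i; have [f1 f2] := Ey i.
  rewrite state_lin1 in l1; rewrite state_lin2 in l2; rewrite state_scale1 in e1.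
  rewrite state_scale2 in e2; rewrite state_lin1 state_opp1 in f1.
  rewrite state_lin2 state_opp2 in f2.
  rewrite !state_lin1 !state_lin2 !state_opp1 !state_opp2.
  split; first exact: cmp l1 e1 f1.
  exact: cmp l2 e2 f2.
have W0 := resolvent_inj Rmu YW E0.
move=> i; have [w1 w2] := W0 i; rewrite state_lin1 in w1; rewrite state_lin2 in w2.
have cmp (u a1 : cfun R) (r : R) : eq_on r (- k *: u + a1) 0 -> eq_on r a1 (k *: u).
  apply: ae_mono => x h xD; have {}h := h xD.
  have : - k * u x + a1 x = 0 by exact: h.
  by rewrite addrC mulNr => /eqP; rewrite subr_eq0 => /eqP.
by rewrite state_scale1 state_scale2; split; exact: cmp.
Qed.

(** At an eigenvalue the estimate of [resolvent_set] fails. *)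
Lemma resolvent_not_eigen mu lambda U : resolvent_set l mu -> inY l U ->
  eqX l (opA l U) (lambda *: U) -> ~ eqX l U 0 -> mu != lambda.
Proof.
move=> Rmu YU EU U0; apply/eqP => ml; apply: U0.
apply: (resolvent_inj Rmu YU) => i.
rewrite state_lin1 state_lin2 state_opp1 state_opp2 ml; have [e1 e2] := EU i.
rewrite state_scale1 in e1; rewrite state_scale2 in e2.
have cmp (r : R) (f g : cfun R) : eq_on r f g -> eq_on r (g - f) 0.
  apply: ae_mono => x h xD; have -> : (g - f) x = g x - f x by [].
  by rewrite h// subrr.
by split; exact: cmp.
Qed.

(** Along fine partitions the sums that define the contour integral are c U with
    |c| small, since their coefficients are the sums that define the winding
    number of the contour around lambda, which is 0. Hence any value w of the
    integral satisfies |w|^2 <= 2 |w - c U|^2 + 2 |c U|^2 with both terms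
    arbitrarily small. If there is no such value, the definition of
    [riesz_proj] returns 0. *)
Lemma riesz_proj_eigen gamma lambda U : riesz_contour l gamma -> inY l U ->
  eqX l (opA l U) (lambda *: U) -> ~ eqX l U 0 -> lambda != 0 ->
  eqX l (riesz_proj l gamma U) 0.
Proof.
move=> [_ Rg _ Wg] YU EU U0 lam0.
have W0 : winding gamma lambda 0 by apply: Wg => //; exists U.
rewrite /riesz_proj; set v := xget _ _.
suff V0 : eqX l v 0.
  have := eqXZ (two_pi_i R)^-1 V0; rewrite scaler0; exact.
rewrite /v; case: xgetP => [w wv [[Vw Lw] Cw]|_]; last exact: eqX_refl.
have XU := inY_X YU.
have LU i : inL2 (l i) (U.1 i) /\ inL2 (l i) (U.2 i).
  by have [[H _ _ _] L] := XU; split; [exact: inH_L2 (H i)|exact: L].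
have LW i : inL2 (l i) (w.1 i) /\ inL2 (l i) (w.2 i).
  by have [H _ _ _] := Vw; split; [exact: inH_L2 (H i)|exact: Lw].
have key (eps : R) : 0 < eps -> exists (c : R[i]) (S : state R N),
    [/\ cmod c < eps, (normX l (S - w) < eps%:E)%E, eqX l S (c *: U)
      & forall i, inL2 (l i) (S.1 i) /\ inL2 (l i) (S.2 i)].
  move=> e0; have [d1 [d10 H1]] := Cw eps e0; have [d2 [d20 H2]] := W0 eps e0.
  have [n n0 nd] : exists2 n, (0 < n)%N & n%:R^-1 < Num.min d1 d2.
    have dm : 0 < Num.min d1 d2 by rewrite lt_min d10.
    have [m _ Hm] := near_infty_natSinv_lt (PosNum dm).
    by exists m.+1 => //; apply: Hm => /=.
  move: nd; rewrite lt_min => /andP[nd1 nd2].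
  have {}H1 := H1 _ _ (tagged_uniform n0 nd1).
  have := H2 _ _ (tagged_uniform n0 nd2).
  rewrite mulr0z mulr0 subr0 lte_fin => {}H2.
  have szn : size (uniform n) = n by rewrite size_mkseq.
  pose tau k := nth 1 (0 :: uniform n) k.
  have Rk (k : 'I_(size (uniform n))) : resolvent_set l (gamma (tau k)).
    apply: Rg; have kn : (k < n)%N by rewrite -[X in (_ < X)%N]szn.
    rewrite /tau nth_uniform0// in_itv/= divr_ge0 ?ler0n//=.
    by rewrite ler_pdivrMr ?ltr0n// mul1r ler_nat ltnW.
  have Hk (k : 'I_(size (uniform n))) :=
    resolvent_eigen (Rk k) YU EU (resolvent_not_eigen (Rk k) YU EU U0).
  eexists; eexists; split; [exact: H2|exact: H1| |].
    apply: eqX_sum => k; have [_ E] := Hk k.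
    rewrite -scalerA; exact: eqXZ.
  move=> i; apply: inL2_sum => k; have [Y _] := Hk k.
  have [[H _ _ _] L] := inY_X Y.
  rewrite state_scale1 state_scale2.
  by split; apply: inL2Z; [exact: inH_L2 (H i)|exact: L].
have fin (r : R) (f u : cfun R) : inL2 r f -> inL2 r u ->
    (forall eps, 0 < eps -> exists (c : R[i]) (s : cfun R),
      [/\ cmod c < eps, (sqnorm r (s - f) <= (eps ^+ 2)%:E)%E, eq_on r s (c *: u)
        & inL2 r s]) -> eq_on r f 0.
  move=> F Lu H; apply: sqnorm_eq0; first exact: inL2_meas.
  have /inL2P[_ nu] := Lu.
  have fu : sqnorm r u \is a fin_num by rewrite ge0_fin_numE ?sqnorm_ge0.
  pose K := 2 + 4 * fine (sqnorm r u).
  have K0 : 0 < K by rewrite /K ltr_wpDr// mulr_ge0// fine_ge0// sqnorm_ge0.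
  apply/eqP; rewrite eq_le sqnorm_ge0 andbT; apply/lee_addgt0Pr => eta eta0.
  rewrite add0e.
  (* K collects the constants of the two applications of [sqnorm_lin], so that
  this choice bounds the squared norm by [eta]. *)
  pose eps := Num.sqrt (eta / K).
  have e0 : 0 < eps by rewrite sqrtr_gt0 divr_gt0.
  have e2 : eps ^+ 2 = eta / K by rewrite sqr_sqrtr// divr_ge0// ltW.
  have [c [s [cc ns es Ls]]] := H eps e0.
  have Lsf : inL2 r (s - f) by apply: inL2D => //; exact: inL2N.
  have E1 : f = (-1) *: (s - f) + s by rewrite scaleN1r opprB subrK.
  have B1 := sqnorm_lin (-1) (inL2_meas Lsf) (inL2_meas Ls); rewrite -E1 in B1.
  apply: le_trans B1 _.
  have c1 : cmod (-1 : R[i]) ^+ 2 = 1.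
    by rewrite cmod_sq /part /= oppr0 expr0n addr0 sqrrN expr1n.
  have B2 := sqnorm_lin c (inL2_meas Lu) (inL2_meas (inL20 r)).
  rewrite addr0 sqnorm0 mule0 adde0 in B2.
  have Es := eq_sqnorm (inL2_meas Ls) (inL2_meas (inL2Z c Lu)) es.
  rewrite c1 mulr1 Es.
  have {}B2 : (sqnorm r (c *: u) <= (2 * eps ^+ 2 * fine (sqnorm r u))%:E)%E.
    apply: le_trans B2 _; rewrite -{1}(fineK fu) -EFinM lee_fin.
    rewrite ler_wpM2r ?fine_ge0 ?sqnorm_ge0// ler_wpM2l//.
    by rewrite lerXn2r ?nnegrE ?cmod_ge0 ?(ltW e0) ?(ltW cc).
  have -> : eta = 2 * eps ^+ 2 + 2 * (2 * eps ^+ 2 * fine (sqnorm r u)).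
    by rewrite e2 /K in K0 *; field; rewrite gt_eqF.
  apply: (@le_trans _ _ (2%:E * (eps ^+ 2)%:E +
      2%:E * (2 * eps ^+ 2 * fine (sqnorm r u))%:E)%E); last exact: lexx.
  by apply: leeD; apply: lee_wpmul2l.
have sqle (T : state R N) i eps : 0 < eps -> (normX l T < eps%:E)%E ->
    (sqnorm (l i) (T.1 i) <= (eps ^+ 2)%:E)%E /\
    (sqnorm (l i) (T.2 i) <= (eps ^+ 2)%:E)%E.
  move=> e0 nT; have [h1 h2] := sqnorm_le_normX T i.
  have le2 : (normX l T ^+ 2 <= (eps ^+ 2)%:E)%E.
    rewrite EFin_expe lee_sqr ?normX_ge0//; last by rewrite lee_fin ltW.
    exact: ltW.
  by split; [exact: le_trans h1 le2|exact: le_trans h2 le2].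
move=> i; have [LU1 LU2] := LU i; have [LW1 LW2] := LW i; split.
  apply: (fin _ _ _ LW1 LU1) => eps e0.
  have [c [S [cc nS ES LS]]] := key eps e0.
  exists c, (S.1 i); have [h _] := sqle _ i _ e0 nS; have [es _] := ES i.
  rewrite state_add1 state_opp1 in h; rewrite state_scale1 in es.
  by have [Ls _] := LS i; split.
apply: (fin _ _ _ LW2 LU2) => eps e0.
have [c [S [cc nS ES LS]]] := key eps e0.
exists c, (S.2 i); have [_ h] := sqle _ i _ e0 nS; have [_ es] := ES i.
rewrite state_add2 state_opp2 in h; rewrite state_scale2 in es.
by have [_ Ls] := LS i; split.
Qed.

End Riesz.

(** * Membership in the domain *)

Section Main.
Context {R : realType} (N : nat) (l : 'I_(2 * N) -> R).
Context (hl : forall i, 0 < l i).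

Lemma eigenvector_domAc gamma mu (U : state R N) : riesz_contour l gamma ->
  inY l U -> eqX l (opA l U) (mu *: U) -> ~ eqX l U 0 -> mu != 0 ->
  domAc l gamma U.
Proof.
move=> G YU EU U0 mu0; have XU := inY_X YU; split; last exact: YU.
split; first exact: XU.
exists U; split; first exact: XU.
have P0 := riesz_proj_eigen hl G YU EU U0 mu0.
move=> i; have [p1 p2] := P0 i.
rewrite state_add1 state_add2 state_opp1 state_opp2.
have cmp (r : R) (f p : cfun R) : eq_on r p 0 -> eq_on r f (f - p).
  apply: ae_mono => x h xD; have -> : (f - p) x = f x - p x by [].
  by rewrite h// subr0.
by split; [exact: (cmp _ _ _ p1)|exact: (cmp _ _ _ p2)].
Qed.

End Main.

(** * The characteristic equation *)

Theorem theorem3p2 (R : realType) (N : nat) (hN : (0 < N)%N)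
    (l : 'I_(2 * N) -> R) (hl : forall i, 0 < l i)
    (gamma : R -> R[i]) (hgamma : riesz_contour l gamma)
    (z : R) (hz : 0 < z) :
  is_eigenvalue l (domAc l gamma) (0 +i* (z ^+ 2)) <-> char_mx l z 0 1 = 0.
Proof.
rewrite -/(iz2 z); split=> [[U [[_ YU] U0 EU]]|ch0].
  apply/eqP; apply: contrapT => /negP ch; apply: U0.
  have [M E2] := eigen_modal EU.
  have E1 := modal_char hl hz hN YU M ch.
  move=> i; split; first exact: E1.
  apply: eq_on_trans (E2 i) _.
  by have := eq_onZ (iz2 z) (E1 i); rewrite scaler0.
have [U [YU U0 EU]] := eigen_exists hl hz hN ch0.
exists U; split; [|exact: U0|exact: EU].
apply: (eigenvector_domAc hl hgamma YU EU U0).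
by apply/eqP => /(congr1 (part false)) /eqP; rewrite /part /= sqrf_eq0 gt_eqF.
Qed.
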